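(* Let $\mathcal{U}$ be a ground set of size $n$, let $\mathcal{X}$ be a set, let $S:2^{\mathcal{U}}\times\mathcal{X}\to\Sigma$ be a sketching map, and let $(\mathtt{Aux}[M_1,M_2])$ be distributions over $\mathcal{X}$ indexed by disjoint $M_1,M_2\subseteq\mathcal{U}$. Let the query thresholds be $A=an$ and $B=bn$ for constants $a,b$ with $0<a<b<1$. Suppose that $S$ has a $\delta$-determining pool $L$ (unknown to the attacker) with $|L|<\min(A,n/2)-\Omega(n)$ and $\delta<n^{-3}$. Then for any query-responder (QR) algorithm, the attack algorithm described in the context (run with the upper bound $|L|$ on the pool size) causes the QR to make at least $\eta r$ incorrect responses, for a constant $\eta>0$, within $r=O(|L|^2\log n)$ rounds, with probability $1-O(n^{-1})$. Moreover, as $b/a\to 1$ (keeping $a,b$ bounded away from $0$ and $1$ by an absolute constant) and $|L|/n\to 0$, the constant $\eta$ approaches $1/4$.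
   Context: Notation: for a set $V$ and $q\in[0,1]$, $\mathrm{Bern}[q]^V$ is the distribution on subsets of $V$ that includes each element independently with probability $q$. Interaction model: in each round the attacker chooses a query $(V,X)$ with $V\subseteq\mathcal{U}$, $X\in\mathcal{X}$; the system computes the sketch $S(V,X)$ and sends it (only) to the QR; the QR returns a bit $Z\in\{0,1\}$. The response is correct if $Z=0$ when $|V|\le A$, $Z=1$ when $|V|\ge B$, and any response is correct when $A<|V|<B$. The QR may be adaptive: its response may depend on all previous sketches (and even on previous queries and the attacker's state, except the attacker's fresh randomness). Rate distribution: choose $0<q_{\min}<q_1<(A-|L|)/n$ and $B/n<q_2<q_{\max}<1$, where each of these inequalities holds with an additive gap bounded below by a positive constant. Let $f(q)=0$ for $q\le q_{\min}$ or $q\ge q_{\max}$, $f(q)=(q-q_{\min})/(q_1-q_{\min})$ on $[q_{\min},q_1]$, $f(q)=1$ on $[q_1,q_2]$, $f(q)=(q_{\max}-q)/(q_{\max}-q_2)$ on $[q_2,q_{\max}]$. Let $\nu$ be the probability density proportional to $f(q)/(q(1-q))$. Attack algorithm (inputs: $r$, the bound $|L|$, $\mathcal{U}$, the distributions $\mathtt{Aux}$, thresholds $A<B$): initialize the mask $M\gets\emptyset$ and counters $C[x]\gets 0$ for all $x\in\mathcal{U}$. For $t=1,\dots,r$: sample $q\sim\nu$; sample $U\sim\mathrm{Bern}[q]^{\mathcal{U}}$; sample $X\sim\mathtt{Aux}[M,U\setminus M]$; send $(U\cup M,X)$ to the system; receive $Z$ from the QR; for each $x\in U\setminus M$, set $C[x]\gets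 C[x]+Z$, and if $C[x]\ge \mathrm{median}\{C[y]:y\in\mathcal{U}\setminus M\}+16\sqrt{r\log(rn)}$, add $x$ to $M$. Determining pool: for $M\subseteq\mathcal{U}$ and $U\subseteq\mathcal{U}$, let $\mathcal{D}(M,U\setminus M)$ be the distribution of $S(U\cup M,X)$ for $X\sim\mathtt{Aux}[M,U\setminus M]$. A set $L\subseteq\mathcal{U}$ is a $\delta$-determining pool if there are distributions $\mathcal{D}'(M,W)$, defined for all $M\subseteq L$ and $W\subseteq L\setminus M$, such that for every $M\subseteq L$ and every $q\in[q_{\min},q_{\max}]$, $\mathbb{E}_{U\sim\mathrm{Bern}[q]^{\mathcal{U}}}\big[\|\mathcal{D}(M,U\setminus M)-\mathcal{D}'(M,U\cap(L\setminus M))\|_{TV}\big]\le\delta$. *)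

(* Defs.v *)
From HB Require Import structures.
From mathcomp Require Import all_boot all_order all_algebra.
From mathcomp Require Import all_classical all_reals all_analysis.
Set Implicit Arguments.
Unset Strict Implicit.
Unset Printing Implicit Defensive.
Import Order.TTheory GRing.Theory Num.Theory.
Import numFieldNormedType.Exports.
Local Open Scope ring_scope.

(* The subsets of a finite ground set, as a discrete measurable space. *)
HB.instance Definition _ (U : finType) :=
  isPointed.Build {set U} finset.set0.
HB.instance Definition _ (U : finType) :=
  @isMeasurable.Build default_measure_display {set U}
    discrete_measurable discrete_measurable0
    discrete_measurableC discrete_measurableU.

Record rates (R : Type) := Rates { qmin : R; q1 : R; q2 : R; qmax : R }.

(* 0 < qmin < q1 < a - lam and b < q2 < qmax < 1, every inequality with an
   additive gap at least g; with a = A/n, lam = |L|/n and b = B/n. *)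
Definition rates_gap (R : realType) (a b lam g : R) (rt : rates R) : Prop :=
  [/\ g <= qmin rt, qmin rt + g <= q1 rt & q1 rt + g <= a - lam] /\
  [/\ b + g <= q2 rt, q2 rt + g <= qmax rt & qmax rt + g <= 1].

Definition trapezoid (R : realType) (rt : rates R) (q : R) : R :=
  if (q <= qmin rt) || (qmax rt <= q) then 0
  else if q <= q1 rt then (q - qmin rt) / (q1 rt - qmin rt)
  else if q <= q2 rt then 1
  else (qmax rt - q) / (qmax rt - q2 rt).

Definition rate_weight (R : realType) (rt : rates R) (q : R) : R :=
  trapezoid rt q / (q * (1 - q)).

(* Density of nu with respect to the Lebesgue measure. *)
Definition rate_density (R : realType) (rt : rates R) (q : R) : R :=
  rate_weight rt q /
  fine (\int[@lebesgue_measure R]_p (rate_weight rt p)%:E)%E.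

(* Mass of W under Bern[q]^U. *)
Definition bern (R : realType) (U : finType) (q : R) (W : {set U}) : R :=
  \prod_(x : U) (if x \in W then q else 1 - q).

Definition tv_dist d (T : measurableType d) (R : realType)
    (P Q : set T -> \bar R) : R :=
  sup [set `|fine (P E) - fine (Q E)| | E in measurable]%classic.

(* The law D(M, W) of S(W u M, X) for X ~ Aux[M, W].  Only the values of Aux
   at disjoint pairs are ever used. *)
Definition sketch_law (R : realType) (U : finType)
    dX (X : measurableType dX) dS (Sg : measurableType dS)
    (S : {set U} -> X -> Sg) (Aux : {set U} -> {set U} -> probability X R)
    (M W : {set U}) : set Sg -> \bar R :=
  pushforward (Aux M W) (S (W :|: M)).

Definition determining_pool (R : realType) (U : finType)
    dX (X : measurableType dX) dS (Sg : measurableType dS)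
    (S : {set U} -> X -> Sg) (Aux : {set U} -> {set U} -> probability X R)
    (rt : rates R) (delta : R) (L : {set U}) : Prop :=
  exists D' : {set U} -> {set U} -> probability Sg R,
  forall (M : {set U}) (q : R),
    M \subset L -> qmin rt <= q <= qmax rt ->
    \sum_(W : {set U}) bern q W *
      tv_dist (sketch_law S Aux M (W :\: M)) (D' M (W :&: (L :\: M)))
    <= delta.

(* The average of the two middle elements when the size is even. *)
Definition median (R : realType) (s : seq nat) : R :=
  let s' := sort leq s in
  ((nth 0 s' (size s).-1./2)%:R + (nth 0 s' (size s)./2)%:R) / 2.

Record attacker (U : finType) :=
  Attacker { mask : {set U}; counter : U -> nat }.

Definition attacker0 (U : finType) : attacker U :=
  Attacker finset.set0 (fun _ => 0%N).

(* One pass of the loop over the elements x of U \ M after the bit z. *)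
Definition visit (R : realType) (U : finType) (r : nat) (z : bool)
    (st : attacker U) (x : U) : attacker U :=
  let C y := (counter st y + (z && (y == x)))%N in
  let M := mask st in
  let bar : R := median R [seq C y | y <- enum (~: M)] +
    16 * Num.sqrt (r%:R * ln (r%:R * #|U|%:R)) in
  Attacker (if bar <= (C x)%:R then x |: M else M) C.

Definition update (R : realType) (U : finType) (r : nat)
    (st : attacker U) (W : {set U}) (z : bool) : attacker U :=
  foldl (visit R r z) st (enum (W :\: mask st)).

(* What happens in one round: the rate q, the set U, the auxiliary X, the
   response Z. *)
Notation round R U X :=
  (measurableTypeR R * {set U} * X * bool)%type (only parsing).

Definition attacker_after (R : realType) (U : finType) dX
    (X : measurableType dX) (r : nat) (h : seq (round R U X)) : attacker U :=
  foldl (fun st e => let: (_, W, _, z) := e in update R r st W z)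
        (attacker0 U) h.

(* A response in an adaptive, randomized strategy: the law of the bit in
   round t.+1 given all of the t past rounds (these determine the past queries
   and sketches and the attacker's state) and the current sketch.  Private
   randomness kept by the responder from round to round is covered, by
   conditioning on this information. *)
Definition responder (R : realType) (U : finType)
    dX (X : measurableType dX) dS (Sg : measurableType dS) :=
  forall t : nat, R.-pker (t.-tuple (round R U X) * Sg) ~> bool.

Definition incorrect (R : realType) (U : finType) (A B : R)
    (V : {set U}) (z : bool) : bool :=
  (#|V|%:R <= A) && z || (B <= #|V|%:R) && ~~ z.

Fixpoint errors_from (R : realType) (U : finType) dX (X : measurableType dX)
    (A B : R) (r : nat) (st : attacker U) (h : seq (round R U X)) : nat :=
  if h is (_, W, _, z) :: h' then
    (incorrect A B (W :|: mask st) z +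
      errors_from A B r (update R r st W z) h')%N
  else 0%N.

Definition errors (R : realType) (U : finType) dX (X : measurableType dX)
    (A B : R) (r : nat) (h : seq (round R U X)) : nat :=
  errors_from A B r (attacker0 U) h.

(* Probability that the full transcript satisfies E, given the first t rounds h,
   when k rounds remain: the iterated integral over q ~ nu, W ~ Bern[q]^U,
   x ~ Aux[M, W \ M] and z ~ response to S(W u M, x), round after round. *)
Fixpoint transcript_prob (R : realType) (U : finType)
    dX (X : measurableType dX) dS (Sg : measurableType dS)
    (S : {set U} -> X -> Sg) (Aux : {set U} -> {set U} -> probability X R)
    (rt : rates R) (qr : responder R U X Sg) (r : nat)
    (E : seq (round R U X) -> bool)
    (k t : nat) (h : t.-tuple (round R U X)) {struct k} : \bar R :=
  if k is k'.+1 then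
    let M := mask (attacker_after r h) in
    (\int[@lebesgue_measure R]_q ((rate_density rt q)%:E *
      \sum_(W : {set U}) ((bern q W)%:E *
        \int[Aux M (W :\: M)]_x \int[qr t (h, S (W :|: M) x)]_z
          transcript_prob S Aux rt qr r E k' (rcons_tuple h (q, W, x, z)))))%E
  else ((E h)%:R)%:E.

Definition attack_prob (R : realType) (U : finType)
    dX (X : measurableType dX) dS (Sg : measurableType dS)
    (S : {set U} -> X -> Sg) (Aux : {set U} -> {set U} -> probability X R)
    (rt : rates R) (qr : responder R U X Sg) (r : nat)
    (E : seq (round R U X) -> bool) : \bar R :=
  transcript_prob S Aux rt qr r E r [tuple].

(* Main.v *)
Require Import Defs.
From HB Require Import structures.
From mathcomp Require Import all_boot all_order all_algebra.
From mathcomp Require Import all_classical all_reals all_analysis.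
From mathcomp Require Import measurable_realfun.
From mathcomp Require Import ring lra zify.
Set Implicit Arguments.
Unset Strict Implicit.
Unset Printing Implicit Defensive.
Import Order.TTheory GRing.Theory Num.Theory.
Import numFieldNormedType.Exports.
Local Open Scope ring_scope.

(** Outside the pool L the response is almost independent of the query, so the score C[x] of x not
    in L stays within O(sqrt(r log(rn))) of the sum S of the rates of the rounds answered 1. As L is
    a minority, the median stays near S too, the mask never leaves L, and no x in L gains more than
    O(sqrt(r log(rn))) over S. On the other hand, let P(q) be the probability of the answer 1 at
    rate q. By Russo's formula the expected gain over S of all of L \ M in one round is
    q(1 - q) P'(q), and the density f(q)/(q(1 - q)) turns its mean over q into
    int f P' = (mean of P on [q2, qmax]) - (mean of P on [qmin, q1]), up to normalization.
    A responder who errs rarely makes this close to 1, which over r = K |L|^2 log n rounds exceeds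
    the |L| O(sqrt(r log(rn))) that L can gain. The bound 1/4 comes from minimizing the error mass
    int f p on [qmin, q1] plus int f (1 - p) on [q2, qmax] for a given mean of P.

    Both concentration statements are proved with exponential supermartingales, by induction on the
    number of remaining rounds. The distance of the response laws enters only as a drift delta per
    round; a coupling of the whole transcript would lose r delta, which is not O(1/n). *)

(** * Bernoulli sets *)

(** A responder may err or leak, and may switch between the two from round to round. Instead of a
    case distinction, one number is followed: the errors so far plus [kap] times the sum of the
    scores in L. Here [kap] is the Lagrange multiplier of the minimization of the error mass, so
    every response law, whatever the past, raises this number in mean by at least a fixed amount
    [be], up to small terms. The scores in L are bounded deterministically, so what remains must be
    errors.

    That bound needs tame scores outside L, which hold only with high probability. No stopping time
    is introduced: both kinds of failure enter one potential [pot], and the induction shows that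
    success has probability at least [1 - pot]. This is trivial once [pot >= 1], and while [pot < 1]
    no score outside L exceeds [D] in absolute value, so the next update is under control.

    A score is frozen when its element enters the mask: from then on the element belongs to every
    query and the attacker no longer counts it. The increment of the sum over L is then what Russo's
    formula computes for L \ M. *)

Section Bernoulli.
Variables (R : realType) (U : finType).
Implicit Types (q : R) (W M : {set U}) (x y : U) (F : {set U} -> R).

Definition dev q x W : R := (x \in W)%:R - q.

Definition devs (A : {set U}) q W : R := \sum_(x in A) dev q x W.

Lemma bern_ge0 q W : 0 <= q <= 1 -> 0 <= bern q W.
Proof.
by case/andP=> q0 q1; apply: prodr_ge0 => x _; case: ifP => _ //; rewrite subr_ge0.
Qed.

Lemma sum_bern q : \sum_(W : {set U}) bern q W = 1.
Proof.
rewrite /bern -(bigA_distr _ _ (fun=> q) (fun=> 1 - q)) big1 // => x _.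
by rewrite /= addrC subrK.
Qed.

Lemma bern_card q W : bern q W = q ^+ #|W| * (1 - q) ^+ (#|U| - #|W|).
Proof.
rewrite /bern (bigID [in W]) /=; congr (_ * _).
  by rewrite (eq_bigr (fun=> q)) ?prodr_const // => x ->.
rewrite (eq_bigr (fun=> 1 - q)); last by move=> x /negbTE ->.
by rewrite prodr_const; congr (_ ^+ _); rewrite -(cardC (mem W)) addKn.
Qed.

Lemma dev_norm q x W : 0 <= q <= 1 -> `|dev q x W| <= 1.
Proof. by case/andP=> q0 q1; rewrite /dev; case: (x \in W); rewrite ler_norml ?mulr1n ?mulr0n; apply/andP; split; lra. Qed.

Let flip x W : {set U} := if x \in W then W :\ x else x |: W.

Let flipK x : involutive (flip x).
Proof.
move=> W; rewrite /flip; have [xW|xW] := boolP (x \in W).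
  by rewrite setD11 finset.setD1K.
by rewrite setU11 finset.setU1K.
Qed.

(* The terms of W :\ x and x |: W cancel. *)
Lemma sum_bern_dev q x F : (forall W, F (W :\ x) = F W) ->
  \sum_(W : {set U}) bern q W * (F W * dev q x W) = 0.
Proof.
move=> FE; set h := (fun W => bern q W * (F W * dev q x W)); rewrite -/(\sum_(W : {set U}) h W).
have hflip W : h (flip x W) = - h W.
  rewrite /h /bern /dev (bigD1 x) //= [in RHS](bigD1 x) //=.
  set A := \prod_(i | _) _; set B := \prod_(i | _) _.
  have -> : A = B.
    apply: eq_bigr => y yx; congr (if _ then _ else _); by rewrite /flip; case: ifP => _; rewrite !inE ?yx ?(negbTE yx).
  have Fx : F (x |: W) = F (W :\ x).
    by rewrite -(FE (x |: W)); congr F; apply/setP => y; rewrite !inE; case: eqP.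
  rewrite /flip; have [xW|xW] := boolP (x \in W); rewrite !inE eqxx /= ?(negbTE xW) ?xW ?FE ?Fx ?FE; ring.
have S0 : \sum_(W : {set U}) h W = - \sum_(W : {set U}) h W.
  rewrite {1}(reindex_inj (inv_inj (flipK x))) -sumrN.
  by apply: eq_bigr => W _; rewrite hflip.
by lra.
Qed.

Lemma devsT q W : devs [set: U] q W = #|W|%:R - #|U|%:R * q.
Proof.
rewrite /devs /dev sumrB sumr_const cardsT mulr_natl; congr (_ - _).
rewrite -sum1_card natr_sum big_mkcond /= [RHS]big_mkcond /=.
by apply: eq_bigr => x _; rewrite inE; case: (x \in W).
Qed.

(** Memberships of distinct elements are independent: the off-diagonal terms of the square vanish by
    [sum_bern_dev], and each of the [#|U|] diagonal terms is at most 1. *)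
Lemma sum_bern_sqr_devs q : 0 <= q <= 1 ->
  \sum_(W : {set U}) bern q W * devs [set: U] q W ^+ 2 <= #|U|%:R.
Proof.
move=> q01.
have E W : bern q W * devs [set: U] q W ^+ 2 =
    \sum_x \sum_y bern q W * (dev q y W * dev q x W).
  rewrite expr2 /devs big_mkcond /= mulr_sumr mulr_sumr; apply: eq_bigr => x _.
  rewrite inE mulr_suml mulr_sumr big_mkcond /=.
  by apply: eq_bigr => y _; rewrite inE.
rewrite (eq_bigr _ (fun W _ => E W)) exchange_big /=.
rewrite -sum1_card natr_sum; apply: ler_sum => x _.
rewrite exchange_big (bigD1 x) //= [X in _ + X]big1 ?addr0 => [|y yx].
  apply: (@le_trans _ _ (\sum_(W : {set U}) bern q W)); last by rewrite sum_bern.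
  apply: ler_sum => W _.
  rewrite -[leRHS]mulr1; apply: ler_wpM2l; first exact: bern_ge0.
  by rewrite -expr2 -real_normK ?num_real // expr_le1 // dev_norm.
apply: sum_bern_dev => W; rewrite /dev !inE.
by rewrite (negbTE yx).
Qed.

Lemma chebyshev_bern q s F : 0 <= q <= 1 -> 0 < s ->
  (forall W, F W <= 1) -> (forall W, 0 < F W -> s <= `|devs [set: U] q W|) ->
  \sum_(W : {set U}) bern q W * F W <= #|U|%:R / s ^+ 2.
Proof.
move=> q01 s0 F1 Fs.
rewrite ler_pdivlMr ?exprn_gt0 //; apply: le_trans (sum_bern_sqr_devs q01).
rewrite mulr_suml; apply: ler_sum => W _; rewrite -mulrA ler_wpM2l ?bern_ge0 //.
have [FW|FW] := ltP 0 (F W); last first.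
  by apply: (@le_trans _ _ 0); [rewrite mulr_le0_ge0 // sqr_ge0|exact: sqr_ge0].
apply: (@le_trans _ _ (s ^+ 2)); first by rewrite -[leRHS]mul1r ler_wpM2r ?sqr_ge0.
by rewrite -[leRHS]real_normK ?num_real // lerXn2r ?nnegrE ?(ltW s0) // Fs.
Qed.

(** A formal polynomial in the rate, so that its derivative is algebraic and it can itself be a
    factor of the primitives used in the integrals over [q]. *)
Definition bern_poly F : {poly R} :=
  \sum_(W : {set U}) F W *: ('X^#|W| * (1 - 'X) ^+ (#|U| - #|W|)).

Lemma bern_polyE F q : (bern_poly F).[q] = \sum_(W : {set U}) bern q W * F W.
Proof.
rewrite /bern_poly horner_sum; apply: eq_bigr => W _.
by rewrite !hornerE bern_card mulrC /= mulrA.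
Qed.

(** The logarithmic derivative of [q^m (1 - q)^(n - m)], multiplied by [q (1 - q)], is [m - n q],
    the centred size of [W]. The identity holds term by term, also at the ends 0 and 1. *)
Lemma russo_formula F q :
  q * (1 - q) * (bern_poly F)^`().[q] = \sum_(W : {set U}) bern q W * (F W * devs [set: U] q W).
Proof.
rewrite /bern_poly raddf_sum horner_sum mulr_sumr; apply: eq_bigr => W _.
rewrite devsT bern_card /= linearZ /= derivM derivXn deriv_exp !poly.derivE !hornerE /=.
have leW : (#|W| <= #|U|)%N by rewrite max_card.
set m := #|W|; set k := (#|U| - m)%N.
have -> : #|U| = (m + k)%N by rewrite subnKC.
rewrite !hornerMn !hornerE natrD.
have X (z : R) j : z * (z ^+ j.-1 *+ j) = j%:R * z ^+ j.
  by case: j => [|j]; rewrite ?mulr0n ?mulr0 ?mul0r // mulrnAr -exprS mulr_natl.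
have -> : q * (1 - q) * F W * (q ^+ m.-1 *+ m * (1 - q) ^+ k +
   q ^+ m * (-1 * (1 - q) ^+ k.-1 *+ k)) =
  F W * ((1 - q) * (1 - q) ^+ k * (q * (q ^+ m.-1 *+ m)) -
   q * q ^+ m * ((1 - q) * ((1 - q) ^+ k.-1 *+ k))).
  rewrite mulN1r mulNrn; ring.
rewrite !X; ring.
Qed.

(** An element that [F] ignores is uncorrelated with [F], by [sum_bern_dev]. This localizes Russo's
    formula from the whole ground set to L \ M. *)
Lemma sum_bern_devs (A B : {set U}) q F : B \subset A ->
  (forall W, F (W :&: B) = F W) ->
  \sum_(W : {set U}) bern q W * (F W * devs A q W) = \sum_(W : {set U}) bern q W * (F W * devs B q W).
Proof.
move=> BA FB; apply/eqP; rewrite -subr_eq0 -sumrB; apply/eqP.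
rewrite (eq_bigr (fun W => \sum_(x in A :\: B) bern q W * (F W * dev q x W))).
  rewrite exchange_big /= big1 // => x; rewrite inE => /andP[xB _].
  apply: sum_bern_dev => W; rewrite -FB -[RHS]FB; congr F; apply/setP => y.
  rewrite !inE; case: (eqVneq y x) => [->|_]. by rewrite (negbTE xB) !andbF. by [].
move=> W _; rewrite -mulrBr -mulrBr -mulr_sumr -mulr_sumr; congr (_ * (_ * _)).
rewrite /devs [X in X - _](big_setID B) /= (finset.setIidPr BA) addrAC subrr add0r.
by [].
Qed.

Lemma devs_norm (A : {set U}) q W : 0 <= q <= 1 -> `|devs A q W| <= #|A|%:R.
Proof.
move=> q01; apply: le_trans (ler_norm_sum _ _ _) _.
rewrite -sum1_card natr_sum; apply: ler_sum => x _; exact: dev_norm.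
Qed.

Lemma sum_bern_dist q d c (p p' G : {set U} -> R) : 0 <= q <= 1 -> 0 <= c ->
  \sum_(W : {set U}) bern q W * `|p W - p' W| <= d -> (forall W, `|G W| <= c) ->
  `|\sum_(W : {set U}) bern q W * (p W * G W) - \sum_(W : {set U}) bern q W * (p' W * G W)| <= c * d.
Proof.
move=> q01 c0 pd Gc; rewrite -sumrB; apply: le_trans (ler_norm_sum _ _ _) _.
apply: le_trans (ler_wpM2l c0 pd); rewrite mulr_sumr; apply: ler_sum => W _.
rewrite -mulrBr -mulrBl normrM (ger0_norm (bern_ge0 W q01)) normrM.
by rewrite [leRHS]mulrCA ler_wpM2l ?bern_ge0 // mulrC ler_wpM2r.
Qed.

End Bernoulli.

(** * Total variation *)

Section LowerIntegral.
Context d (T : measurableType d) (R : realType) (mu : {measure set T -> \bar R}).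
Local Open Scope ereal_scope.
Import HBNNSimple.

(* Nothing is assumed measurable: the integral of a nonnegative function is a lower integral.
   This makes it unnecessary to prove that transcript_prob is measurable in the transcript. *)
Lemma ge0_le_lower_integral (f g : T -> \bar R) :
  (forall x, 0 <= f x) -> (forall x, f x <= g x) ->
  \int[mu]_x f x <= \int[mu]_x g x.
Proof.
move=> f0 fg; have g0 x : 0 <= g x by exact: le_trans (f0 x) (fg x).
rewrite !ge0_integralTE //; apply: le_ereal_sup => _ [h hf <-].
by exists h => // x; exact: le_trans (hf x) (fg x).
Qed.

End LowerIntegral.

Section Staircase.
Variable R : realType.

(** The sum is the integer part of [y] capped at [N]. The induction keeps the saturated case, where
    the count equals [N], as a separate alternative. *)
Lemma staircase_count (N : nat) (y : R) : 0 <= y ->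
  let c : R := \sum_(i < N) (i.+1%:R <= y)%R%:R in
  c <= y /\ (y <= N%:R -> y <= c + 1).
Proof.
move=> y0 /=.
suff [H1 H2] : \sum_(i < N) (i.+1%:R <= y)%R%:R <= y /\
    (y < \sum_(i < N) (i.+1%:R <= y)%R%:R + 1 \/ \sum_(i < N) (i.+1%:R <= y)%R%:R = N%:R :> R).
  split=> // yN; case: H2 => [/ltW //|->].
  by apply: (le_trans yN); rewrite lerDl.
elim: N => [|N [IH1 IH2]]; first by rewrite big_ord0; split=> //; right.
rewrite big_ord_recr /=; have cN : \sum_(i < N) (i.+1%:R <= y)%R%:R <= N%:R :> R.
  rewrite -[leRHS](@mulr_natl R) mulr1 -[N in leRHS]card_ord -sum1_card natr_sum.
  by apply: ler_sum => i _; rewrite lern1 leq_b1.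
move: IH1 IH2 cN; set c := \sum_(i < N) _ => IH1 IH2 cN.
have SN : N.+1%:R = N%:R + 1 :> R by rewrite -natr1.
have [yN|yN] := leP N.+1%:R y; rewrite ?mulr1n ?mulr0n ?addr0.
  have -> : c = N%:R by case: IH2 => // h; lra.
  by rewrite -SN; split => //; right.
split => //; left; case: IH2 => // ->; lra.
Qed.

End Staircase.

Section TotalVariation.
Local Open Scope classical_set_scope.
Context d (T : measurableType d) (R : realType).

(** Rounding [f] down to a multiple of [1/N] loses at most [1/N], and the rounded function is an
    average of indicators of [N] superlevel sets. This links integrals to [tv_dist], which is a
    supremum over events. *)
Lemma Rintegral_staircase d' (X : measurableType d') (P : probability X R)
    (f : X -> R) (N : nat) :
  measurable_fun setT f -> (forall x, 0 <= f x <= 1) -> (0 < N)%N ->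
  `|\int[P]_x f x - N%:R^-1 *
     \sum_(i < N) fine (P [set x | i.+1%:R <= N%:R * f x])| <= N%:R^-1.
Proof.
move=> mf f01 N0; have N0' : 0 < N%:R :> R by rewrite ltr0n.
set E := fun i : 'I_N => [set x | i.+1%:R <= N%:R * f x].
have mE i : measurable (E i).
  have mg : measurable_fun setT (fun x => N%:R * f x) by exact: measurable_funM.
  have := mg measurableT `[i.+1%:R, +oo[%classic (measurable_itv _).
  rewrite setTI; congr measurable; apply/seteqP; split => x /=.
    by rewrite in_itv /= andbT.
  by rewrite in_itv /= andbT.
have intb (g : X -> R) : measurable_fun setT g -> (forall x, `|g x| <= 1) ->
    P.-integrable setT (EFin \o g).
  move=> mg g1; apply: measurable_bounded_integrable => //.
    by rewrite -ge0_fin_numE //; exact: fin_num_measure.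
  exists 1; split => // M M1 x _; exact: le_trans (g1 x) (ltW M1).
have intf : P.-integrable setT (EFin \o f).
  by apply: intb => // x; have /andP[h1 h2] := f01 x; rewrite ger0_norm.
have intE i : P.-integrable setT (EFin \o (\1_(E i) : X -> R)).
  apply: intb => [|x]; first exact: measurable_indic.
  by rewrite indicE; case: (x \in E i); rewrite ?normr1 ?normr0.
set s : X -> R := fun x => N%:R^-1 * \sum_(i < N) \1_(E i) x.
have sumint (l : seq 'I_N) :
    P.-integrable setT (EFin \o (fun x => \sum_(i <- l) \1_(E i) x : R)) /\
    \int[P]_x (\sum_(i <- l) \1_(E i) x) = \sum_(i <- l) fine (P (E i)).
  elim: l => [|i l [IH1 IH2]].
    split.
      apply: intb => [|x]; last by rewrite big_nil normr0.
      by under eq_fun do rewrite big_nil; exact: measurable_cst.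
    under eq_Rintegral do rewrite big_nil.
    by rewrite big_nil Rintegral_cst // mul0r.
  have eqf : (fun x => \sum_(j <- i :: l) \1_(E j) x : R) =
      (fun x => \1_(E i) x + \sum_(j <- l) \1_(E j) x).
    by apply/funext => x; rewrite big_cons.
  split.
    by rewrite eqf; exact: (integrableD measurableT (intE i) IH1).
  rewrite eqf RintegralD // IH2 big_cons; congr (_ + _).
  by rewrite /Rintegral integral_indic // setIT.
have [i1 i2] := sumint (index_enum 'I_N).
have ints : P.-integrable setT (EFin \o s).
  exact: (integrableZl measurableT (N%:R^-1) i1).
have <- : \int[P]_x s x = N%:R^-1 * \sum_(i < N) fine (P (E i)).
  by rewrite -i2 -RintegralZl.
have sf x : s x <= f x /\ f x <= s x + N%:R^-1.
  have /andP[h0 h1] := f01 x.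
  have y0 : 0 <= N%:R * f x by rewrite mulr_ge0.
  have [] := @staircase_count R N _ y0.
  have -> : \sum_(i < N) (i.+1%:R <= N%:R * f x)%R%:R = N%:R * s x :> R.
    rewrite /s mulrA mulfV ?gt_eqF // mul1r; apply: eq_bigr => i _.
    by rewrite indicE /E mem_setE.
  rewrite ler_pM2l // => -> /(_ _) h; split => //.
  rewrite -(ler_pM2l N0') mulrDr mulfV ?gt_eqF // h //.
  by rewrite -[leRHS]mulr1 ler_pM2l.
have le1 : \int[P]_x s x <= \int[P]_x f x.
  by apply: le_Rintegral => // x _; case: (sf x).
have le2 : \int[P]_x f x <= \int[P]_x s x + N%:R^-1.
  have intc : P.-integrable setT (EFin \o cst (N%:R^-1)).
    exact: finite_measure_integrable_cst.
  have -> : N%:R^-1 = \int[P]_x (cst N%:R^-1 x) :> R.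
    by rewrite Rintegral_cst // (_ : fine _ = 1) ?mulr1 //; exact: congr1 (probability_setT P).
  rewrite -RintegralD //; apply: le_Rintegral => //; last by move=> x _; case: (sf x).
  exact: (integrableD measurableT ints intc).
rewrite ger0_norm; last by rewrite subr_ge0.
by rewrite lerBlDl.
Qed.

Lemma tv_dist_ge (d' : measure_display) (X : measurableType d')
    (P : probability X R) (g : X -> T) (Q : probability T R) (E : set T) :
  measurable_fun setT g -> measurable E ->
  `|fine (P (g @^-1` E)) - fine (Q E)| <= tv_dist (pushforward P g) Q.
Proof.
(* The real [sup] dominates the elements of a set only if the set is bounded above; differences of
   probabilities are bounded by 1. *)
move=> mg mE; apply: ub_le_sup; last by exists E.
exists 1 => _ [A mA <-].
have m1 : measurable (g @^-1` A) by rewrite -[X in measurable X]setTI; exact: mg.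
have p1 d1 (Y : measurableType d1) (M : probability Y R) (B : set Y) : measurable B ->
    0 <= fine (M B) <= 1.
  move=> mB; rewrite fine_ge0 //= -lee_fin fineK ?probability_le1 //.
  exact: fin_num_measure.
have /andP[a0 a1] := p1 _ _ P _ m1; have /andP[b0 b1] := p1 _ _ Q _ mA.
rewrite /pushforward ler_norml; apply/andP; split; lra.
Qed.

(* Approximate f by its staircases, whose integrals are averages of measures of level sets. *)
Lemma Rintegral_tv_dist (d' : measure_display) (X : measurableType d')
    (P : probability X R) (g : X -> T) (Q : probability T R) (f : T -> R) :
  measurable_fun setT g -> measurable_fun setT f -> (forall x, 0 <= f x <= 1) ->
  `|\int[P]_x f (g x) - \int[Q]_x f x| <= tv_dist (pushforward P g) Q.
Proof.
move=> mg mf f01; apply/ler_addgt0Pr => e e0.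
(* Both integrals are replaced by staircases, at a cost of [1/N] each. *)
set N := (Num.truncn (2 / e)).+1.
have N0 : 0 < N%:R :> R by rewrite ltr0n.
have Ne : N%:R^-1 + N%:R^-1 <= e.
  have : 2 / e < N%:R by rewrite truncnS_gt.
  rewrite ltr_pdivrMr // => h.
  have : 2 * N%:R^-1 <= e * N%:R * N%:R^-1.
    by rewrite ler_pM2r ?invr_gt0 // mulrC ltW.
  by rewrite -mulrA mulfV ?gt_eqF // mulr1; lra.
have h1 := @Rintegral_staircase _ X P (f \o g) N (measurableT_comp mf mg)
  (fun x => f01 (g x)) isT.
have h2 := @Rintegral_staircase _ T Q f N mf f01 isT.
have h3 : `|N%:R^-1 * \sum_(i < N) fine (P [set x | i.+1%:R <= N%:R * (f \o g) x]) -
    N%:R^-1 * \sum_(i < N) fine (Q [set x | i.+1%:R <= N%:R * f x])|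
    <= tv_dist (pushforward P g) Q.
  rewrite -mulrBr -sumrB normrM ger0_norm ?invr_ge0 ?ler0n //.
  rewrite ler_pdivrMl //; apply: le_trans (ler_norm_sum _ _ _) _.
  have -> : N%:R * tv_dist (pushforward P g) Q =
      \sum_(i < N) tv_dist (pushforward P g) Q.
    by rewrite sumr_const card_ord mulr_natl.
  apply: ler_sum => i _; apply: (@tv_dist_ge _ _ P g Q [set x | i.+1%:R <= N%:R * f x]) => //.
  have mh : measurable_fun setT (fun x => N%:R * f x) by exact: measurable_funM.
  have := mh measurableT `[i.+1%:R, +oo[%classic (measurable_itv _).
  by rewrite setTI; congr measurable; apply/seteqP; split => x /=; rewrite in_itv /= andbT.
move: h1 h2 h3 Ne; set a := \int[P]_x _; set b := N%:R^-1 * _; set c := \int[Q]_x _.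
set b' := N%:R^-1 * _; set t := tv_dist _ _ => h1 h2 h3 Ne.
have -> : a - c = (a - b) + (b - b') - (c - b') by ring.
apply: le_trans (ler_normB _ _) _; have := ler_normD (a - b) (b - b'); lra.
Qed.

End TotalVariation.

(** * The rate distribution *)

Definition rates_ok (R : realType) (rt : rates R) : Prop :=
  [/\ 0 < qmin rt, qmin rt < q1 rt, q1 rt < q2 rt, q2 rt < qmax rt & qmax rt < 1].

Section RateDistribution.
Variables (R : realType) (rt : rates R).
Local Notation lo := (qmin rt).
Local Notation l1 := (q1 rt).
Local Notation l2 := (q2 rt).
Local Notation hi := (qmax rt).
Local Notation mu := (@lebesgue_measure R).
Hypothesis ok : rates_ok rt.

Local Notation w1 := (l1 - lo).
Local Notation w2 := (hi - l2).
Local Notation m0 := (lo * (1 - hi)).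
Local Notation Mx := (hi * (1 - lo)).
Local Notation w := (rate_weight rt).

Let w1_gt0 : 0 < w1. Proof. by case: ok => *; rewrite subr_gt0. Qed.
Let w2_gt0 : 0 < w2. Proof. by case: ok => *; rewrite subr_gt0. Qed.

Lemma rate_var_bounds q : lo <= q <= hi -> m0 <= q * (1 - q) <= Mx.
Proof. by case: ok => lo0 lol1 l12 l2hi hi1 /andP[h1 h2]; apply/andP; split; apply: ler_pM; lra. Qed.

Lemma rate_min_gt0 : 0 < m0.
Proof. by case: ok => *; rewrite mulr_gt0 // subr_gt0. Qed.

Lemma rate_weight_eq0 q : ~~ (lo <= q <= hi) -> w q = 0.
Proof.
rewrite negb_and -!ltNge /rate_weight /trapezoid => /orP[] h; rewrite (ltW h) ?orbT mul0r //.
Qed.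

(* Since f vanishes outside [qmin, qmax], q(1 - q) may be cut off below at its least value there,
   which makes the formula continuous at 0 and 1. *)
Lemma rate_weightE : w = (fun q =>
  Num.max 0 (Num.min 1 (Num.min ((q - lo) / w1) ((hi - q) / w2))) / Num.max m0 (q * (1 - q))).
Proof.
case: ok => lo0 lol1 l12 l2hi hi1.
apply/funext => q; have [qI|qI] := boolP (lo <= q <= hi); last first.
  rewrite rate_weight_eq0 // (_ : Num.max 0 _ = 0) ?mul0r //.
  apply/max_idPl; rewrite !ge_min; move: qI; rewrite negb_and -!ltNge => /orP[] h.
    by rewrite [X in _ || (X || _)]pmulr_lle0 ?invr_gt0 // subr_le0 (ltW h) orbT.
  by rewrite [X in _ || (_ || X)]pmulr_lle0 ?invr_gt0 // subr_le0 (ltW h) !orbT.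
have /andP[h1 _] := rate_var_bounds qI.
rewrite (max_idPr h1) /rate_weight; congr (_ / _).
case/andP: qI => qlo qhi; rewrite /trapezoid.
have [qlo'|qlo'] := leP q lo.
  have -> : q = lo by apply/le_anti/andP.
  by rewrite /= subrr mul0r; apply/esym/max_idPl; rewrite !ge_min lexx orbT.
have [qhi'|qhi'] := leP hi q.
  have -> : q = hi by apply/le_anti/andP.
  by rewrite /= subrr mul0r; apply/esym/max_idPl; rewrite !ge_min lexx !orbT.
rewrite /=.
have e1 : (1 <= (q - lo) / w1) = (l1 <= q) by rewrite ler_pdivlMr // mul1r lerD2r.
have e2 : (1 <= (hi - q) / w2) = (q <= l2) by rewrite ler_pdivlMr // mul1r lerD2l lerN2.
have p1 : 0 <= (q - lo) / w1 by rewrite divr_ge0 // ?subr_ge0 // ltW.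
have p2 : 0 <= (hi - q) / w2 by rewrite divr_ge0 // ?subr_ge0 // ltW.
have [ql1|ql1] := leP q l1.
  have h2 : 1 <= (hi - q) / w2 by rewrite e2 (le_trans ql1) // ltW.
  have h3 : (q - lo) / w1 <= 1 by rewrite ler_pdivrMr // mul1r lerD2r.
  rewrite (min_idPl (le_trans h3 h2)) (min_idPr h3).
  by rewrite (max_idPr p1).
have h3 : 1 <= (q - lo) / w1 by rewrite e1 ltW.
have [ql2|ql2] := leP q l2.
  by rewrite (min_idPl _) ?(max_idPr ler01) // le_min h3 e2.
have h4 : (hi - q) / w2 <= 1 by rewrite ler_pdivrMr // mul1r lerD2l lerN2 ltW.
rewrite (min_idPr (le_trans h4 h3)) (min_idPr h4).
by rewrite (max_idPr p2).
Qed.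

Lemma continuous_rate_weight : continuous w.
Proof.
rewrite rate_weightE => q.
have c1 : {for q, continuous (fun q : R => (q - lo) / w1)}.
  by apply: cvgMl; apply: cvgB => //; exact: cvg_cst.
have c2 : {for q, continuous (fun q : R => (hi - q) / w2)}.
  by apply: cvgMl; apply: cvgB => //; exact: cvg_cst.
have c3 : {for q, continuous (fun q : R => q * (1 - q))}.
  by apply: cvgM => //; apply: cvgB => //; exact: cvg_cst.
have c4 := continuous_min c1 c2.
have c5 := continuous_min (@cst_continuous _ _ (1 : R^o) q) c4.
have c6 := continuous_max (@cst_continuous _ _ (0 : R^o) q) c5.
have c7 := continuous_max (@cst_continuous _ _ (m0 : R^o) q) c3.
apply: cvgM; first exact: c6.
by apply: cvgV; [rewrite gt_eqF // lt_max rate_min_gt0|exact: c7].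
Qed.

Lemma rate_weight_ge0 q : 0 <= w q.
Proof.
rewrite rate_weightE divr_ge0 // le_max ?lexx // ltW // rate_min_gt0 //.
Qed.

Lemma continuous_integrable_itv (f : R -> R) u v : continuous f ->
  mu.-integrable `[u, v]%classic (EFin \o f).
Proof.
move=> cf; apply: continuous_compact_integrable; first exact: segment_compact.
exact: continuous_subspaceT.
Qed.

Lemma Rintegral_itv_split (f : R -> R) u v t : continuous f -> u <= v -> v <= t ->
  \int[mu]_(q in `[u, t]) f q = \int[mu]_(q in `[u, v]) f q + \int[mu]_(q in `[v, t]) f q.
Proof.
move=> cf uv vt; have it x y := @continuous_integrable_itv f x y cf.
have := @Rintegral_itvB R f (BLeft u) (BRight t) v (it u t).
rewrite !bnd_simp => /(_ uv vt) h.
rewrite -(Rintegral_itv_obnd_cbnd (r := v)); last first.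
  apply: integrableS (it v t) => //; by move=> x /=; rewrite !in_itv /= => /andP[/ltW -> ->].
by rewrite -h addrC subrK.
Qed.

(** The rule behind all estimates of integrals here. The integrands contain [1 / (q (1 - q))], which
    has no polynomial primitive, so they are only minorized by derivatives of polynomials. Upper
    bounds come from applying the rule to the negated integrand. *)
Lemma Rintegral_ge_poly (f : R -> R) (H : {poly R}) u v : u < v -> continuous f ->
  (forall q, u <= q <= v -> H^`().[q] <= f q) ->
  H.[v] - H.[u] <= \int[mu]_(q in `[u, v]) f q.
Proof.
move=> uv cf Hf.
have cH (p : {poly R}) : continuous (horner p) by move=> x; exact: continuous_horner.
have -> : H.[v] - H.[u] = \int[mu]_(q in `[u, v]) (H^`()).[q].
  rewrite /Rintegral (@continuous_FTC2 _ _ (horner H)) //.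
  - by apply: continuous_subspaceT; exact: cH.
  - split; first by move=> x _; exact: derivable_horner.
    + by apply: cvg_at_right_filter; exact: cH.
    + by apply: cvg_at_left_filter; exact: cH.
  - by move=> x _; rewrite derivE.
by apply: le_Rintegral => //; exact: continuous_integrable_itv.
Qed.

Definition rate_int (f : R -> R) : R := \int[mu]_(q in `[lo, hi]) (w q * f q).

Definition rate_mass : R := fine (\int[mu]_p (w p)%:E)%E.

Lemma rate_massE : (\int[mu]_p (w p)%:E)%E = rate_mass%:E /\ rate_mass = rate_int (fun=> 1).
Proof.
have h : (\int[mu]_p (w p)%:E = \int[mu]_(p in `[lo, hi]) (w p)%:E)%E.
  rewrite [RHS]integral_mkcond; apply: eq_integral => p _.
  rewrite /patch; case: ifPn => // /negP; rewrite inE /= in_itv /= => hp.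
  by rewrite rate_weight_eq0 //; apply/negP.
have fin : (\int[mu]_(p in `[lo, hi]) (w p)%:E)%E \is a fin_num.
  apply: integrable_fin_num => //.
  exact: (@continuous_integrable_itv w lo hi continuous_rate_weight).
split; first by rewrite /rate_mass fineK // h.
rewrite /rate_mass h /rate_int /Rintegral; congr fine.
by apply: eq_integral => p _; rewrite mulr1.
Qed.

Lemma continuous_rate_mul (f : R -> R) : continuous f -> continuous (fun q => w q * f q).
Proof. by move=> cf q; apply: cvgM; [exact: continuous_rate_weight|exact: cf]. Qed.

Lemma le_rate_int (f g : R -> R) : continuous f -> continuous g ->
  (forall q, lo <= q <= hi -> f q <= g q) -> rate_int f <= rate_int g.
Proof.
move=> cf cg fg; apply: le_Rintegral => //.
- by apply: continuous_integrable_itv; exact: continuous_rate_mul.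
- by apply: continuous_integrable_itv; exact: continuous_rate_mul.
- by move=> q /=; rewrite in_itv /= => hq; rewrite ler_wpM2l ?rate_weight_ge0 // fg.
Qed.

Lemma rate_int_affine (a b : R) (f : R -> R) : continuous f ->
  rate_int (fun q => a + b * f q) = a * rate_mass + b * rate_int f.
Proof.
move=> cf; have [_ ->] := rate_massE; rewrite /rate_int.
have i1 : mu.-integrable `[lo, hi]%classic (EFin \o (fun q => w q * 1)).
  apply: continuous_integrable_itv; apply: continuous_rate_mul => q; exact: cst_continuous.
have i2 : mu.-integrable `[lo, hi]%classic (EFin \o (fun q => w q * f q)).
  by apply: continuous_integrable_itv; exact: continuous_rate_mul.
rewrite -!RintegralZl // -RintegralD //.
- by apply: eq_Rintegral => q _; ring.
- exact: (integrableZl _ a i1).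
- exact: (integrableZl _ b i2).
Qed.

Lemma rate_int_pieces (f : R -> R) (H1 H2 H3 : {poly R}) : continuous f ->
  (forall q, lo <= q <= l1 -> H1^`().[q] <= f q) ->
  (forall q, l1 <= q <= l2 -> H2^`().[q] <= f q) ->
  (forall q, l2 <= q <= hi -> H3^`().[q] <= f q) ->
  (H1.[l1] - H1.[lo]) + (H2.[l2] - H2.[l1]) + (H3.[hi] - H3.[l2]) <=
  \int[mu]_(q in `[lo, hi]) f q.
Proof.
case: ok => lo0 lol1 l12 l2hi hi1 cf e1 e2 e3.
rewrite (@Rintegral_itv_split f lo l2 hi) //; [|lra|lra].
rewrite (@Rintegral_itv_split f lo l1 l2) //; [|lra|lra].
by do 2 (apply: lerD; last exact: Rintegral_ge_poly); exact: Rintegral_ge_poly.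
Qed.

(** Besides the corners of the trapezoid there is one cut inside each ramp: in [rate_gain] these are
    the points where the cheapest responder switches its answer. *)
Lemma rate_int_pieces5 (f : R -> R) (H1 H2 H3 H4 H5 : {poly R}) u v :
  continuous f -> lo < u -> u < l1 -> l2 < v -> v < hi ->
  (forall q, lo <= q <= u -> H1^`().[q] <= f q) ->
  (forall q, u <= q <= l1 -> H2^`().[q] <= f q) ->
  (forall q, l1 <= q <= l2 -> H3^`().[q] <= f q) ->
  (forall q, l2 <= q <= v -> H4^`().[q] <= f q) ->
  (forall q, v <= q <= hi -> H5^`().[q] <= f q) ->
  (H1.[u] - H1.[lo]) + (H2.[l1] - H2.[u]) + (H3.[l2] - H3.[l1]) +
  (H4.[v] - H4.[l2]) + (H5.[hi] - H5.[v]) <= \int[mu]_(q in `[lo, hi]) f q.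
Proof.
case: ok => lo0 lol1 l12 l2hi hi1 cf h1 h2 h3 h4 e1 e2 e3 e4 e5.
rewrite (@Rintegral_itv_split f lo v hi) //; [|lra|lra].
rewrite (@Rintegral_itv_split f lo l2 v) //; [|lra|lra].
rewrite (@Rintegral_itv_split f lo l1 l2) //; [|lra|lra].
rewrite (@Rintegral_itv_split f lo u l1) //; [|lra|lra].
by do 4 (apply: lerD; last exact: Rintegral_ge_poly); exact: Rintegral_ge_poly.
Qed.

Lemma rate_weight_low q : lo <= q <= l1 -> w q = (q - lo) / w1 / (q * (1 - q)).
Proof.
case: ok => lo0 lol1 l12 l2hi hi1 /andP[h1 h2]; rewrite /rate_weight /trapezoid.
have [ql|ql] := leP q lo.
  have -> : q = lo by apply/le_anti/andP.
  by rewrite /= subrr !mul0r.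
by rewrite leNgt (_ : q < hi) /= ?h2 //; lra.
Qed.

Lemma rate_weight_mid q : l1 <= q <= l2 -> w q = (q * (1 - q))^-1.
Proof.
case: ok => lo0 lol1 l12 l2hi hi1 /andP[h1 h2]; rewrite /rate_weight /trapezoid.
rewrite leNgt (_ : lo < q) /=; last by lra.
rewrite leNgt (_ : q < hi) /=; last by lra.
have [ql|ql] := leP q l1; last by rewrite h2 mul1r.
have -> : q = l1 by apply/le_anti/andP.
by rewrite mulfV ?gt_eqF // mul1r.
Qed.

Lemma rate_weight_high q : l2 <= q <= hi -> w q = (hi - q) / w2 / (q * (1 - q)).
Proof.
case: ok => lo0 lol1 l12 l2hi hi1 /andP[h1 h2]; rewrite /rate_weight /trapezoid.
rewrite leNgt (_ : lo < q) /=; last by lra.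
have [ql|ql] := leP hi q.
  have -> : q = hi by apply/le_anti/andP.
  by rewrite subrr !mul0r.
rewrite leNgt (_ : l1 < q) /=; last by lra.
have [ql2|//] := leP q l2.
have -> : q = l2 by apply/le_anti/andP.
by rewrite mulfV ?gt_eqF.
Qed.

Lemma rate_inv_bounds q : lo <= q <= hi ->
  0 < q * (1 - q) /\ Mx^-1 <= (q * (1 - q))^-1 <= m0^-1.
Proof.
move=> hq; have /andP[h1 h2] := rate_var_bounds hq; have m0p := rate_min_gt0.
have qp : 0 < q * (1 - q) by exact: lt_le_trans h1.
by split => //; rewrite !lef_pV2 ?posrE ?h1 ?h2 // (lt_le_trans qp).
Qed.

(** Only the plateau is counted: there the weight is [1 / (q (1 - q))], which is at least 1. *)
Lemma rate_mass_gt0 : 0 < rate_mass.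
Proof.
have [_ ->] := rate_massE; case: ok => lo0 lol1 l12 l2hi hi1.
have c1 : continuous (fun q : R => w q * 1).
  by apply: continuous_rate_mul => q; exact: cst_continuous.
have w0 q : 0 <= w q * 1 by rewrite mulr1 rate_weight_ge0.
apply: lt_le_trans (@rate_int_pieces _ 0 'X 0 c1 _ _ _).
- by rewrite !horner0 !hornerX; lra.
- by move=> q _; rewrite deriv0 horner0.
- move=> q hq; rewrite derivX hornerC mulr1 rate_weight_mid //.
  have hq' : lo <= q <= hi by apply/andP; split; lra.
  have [qp _] := rate_inv_bounds hq'.
  by rewrite -invr1 lef_pV2 ?posrE //; nra.
- by move=> q _; rewrite deriv0 horner0.
Qed.

(** The area of the trapezoid times [1 / m0], the largest value of [1 / (q (1 - q))] allowed by
    [rate_var_bounds]. *)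
Lemma rate_mass_le : rate_mass <= (w1 + 2 * (l2 - l1) + w2) / (2 * m0).
Proof.
have [_ E1] := rate_massE.
have [m mE mp] : exists2 m, m = m0 & 0 < m by exists m0; rewrite ?rate_min_gt0.
have v1 := w1_gt0; have v2 := w2_gt0.
have cst1 : continuous (fun _ : R => 1 : R) by move=> q; exact: cst_continuous.
have E2 : rate_int (fun=> 0 + -1 * 1) = - rate_mass.
  by rewrite (rate_int_affine _ _ cst1) -E1; ring.
have c1 : continuous (fun q : R => w q * (0 + -1 * 1)).
  by apply: continuous_rate_mul => q; exact: cst_continuous.
pose H1 : {poly R} := (- (2 * w1 * m)^-1)%:P * ('X - lo%:P) ^+ 2.
pose H2 : {poly R} := (- m^-1)%:P * 'X.
pose H3 : {poly R} := ((2 * w2 * m)^-1)%:P * (hi%:P - 'X) ^+ 2.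
have D1 q : H1^`().[q] = - ((q - lo) / w1 * m^-1).
  by rewrite /H1 !poly.derivE !hornerE /=; field; rewrite ?gt_eqF.
have D2 q : H2^`().[q] = - m^-1 by rewrite /H2 !poly.derivE !hornerE.
have D3 q : H3^`().[q] = - ((hi - q) / w2 * m^-1).
  by rewrite /H3 !poly.derivE !hornerE /=; field; rewrite ?gt_eqF.
have F1 q : H1.[q] = - ((q - lo) ^+ 2 / (2 * w1 * m)) by rewrite /H1 !hornerE /=; ring.
have F2 q : H2.[q] = - (q / m) by rewrite /H2 !hornerE /=; ring.
have F3 q : H3.[q] = (hi - q) ^+ 2 / (2 * w2 * m) by rewrite /H3 !hornerE /=; ring.
have le_hi q : l2 <= q <= hi -> lo <= q <= hi.
  by case: ok => *; apply/andP; split; lra.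
have le_lo q : lo <= q <= l1 -> lo <= q <= hi.
  by case: ok => *; apply/andP; split; lra.
have le_mid q : l1 <= q <= l2 -> lo <= q <= hi.
  by case: ok => *; apply/andP; split; lra.
rewrite -mE -lerN2 -E2; apply: le_trans (@rate_int_pieces _ H1 H2 H3 c1 _ _ _).
- rewrite !F1 !F2 !F3 !subrr !expr0n /= !mul0r oppr0 le_eqVlt; apply/orP; left; apply/eqP.
  by field; rewrite ?gt_eqF.
- move=> q hq; rewrite D1 rate_weight_low // add0r mulr1 mulrN1 lerN2.
  have [qp /andP[_]] := rate_inv_bounds (le_lo q hq); rewrite -mE => h.
  by case/andP: hq => hq _; apply: ler_wpM2l => //; apply: divr_ge0; [rewrite subr_ge0|exact: ltW].
- move=> q hq; rewrite D2 rate_weight_mid // add0r mulr1 mulrN1 lerN2.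
  by have [qp /andP[_]] := rate_inv_bounds (le_mid q hq); rewrite -mE.
- move=> q hq; rewrite D3 rate_weight_high // add0r mulr1 mulrN1 lerN2.
  have [qp /andP[_]] := rate_inv_bounds (le_hi q hq); rewrite -mE => h.
  by case/andP: hq => _ hq; apply: ler_wpM2l => //; apply: divr_ge0; [rewrite subr_ge0|exact: ltW].
Qed.

(** [F] need not be measurable, so it is compared with the continuous minorant [max 0 (1 - phi)].
    The truncation at 0 is what monotonicity of the lower integral requires; where [1 - phi] is
    negative it only helps. *)
Lemma rate_expect_ge (F : R -> \bar R) (phi : R -> R) c :
  (forall q : R, lo <= q <= hi -> (0 <= F q)%E) -> continuous phi ->
  (forall q, lo <= q <= hi -> ((1 - phi q)%:E <= F q)%E) ->
  rate_int phi <= c * rate_mass ->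
  ((1 - c)%:E <= \int[mu]_q ((rate_density rt q)%:E * F q))%E.
Proof.
move=> F0 cphi hF hc; have N0 := rate_mass_gt0.
have dE q : rate_density rt q = w q / rate_mass by [].
have d0 q : 0 <= rate_density rt q by rewrite dE divr_ge0 ?rate_weight_ge0 // ltW.
pose G q : R := rate_density rt q * Num.max 0 (1 - phi q).
have G0 q : 0 <= G q by rewrite /G mulr_ge0 // le_max lexx.
apply: (@le_trans _ _ (\int[mu]_q (G q)%:E)%E); last first.
  apply: ge0_le_lower_integral => q; first by rewrite lee_fin.
  rewrite /G EFinM; have [hq|hq] := boolP (lo <= q <= hi); last first.
    by rewrite dE rate_weight_eq0 // mul0r !mul0e.
  apply: lee_wpmul2l; first by rewrite lee_fin.
  by rewrite EFin_max ge_max (F0 q hq) (hF q hq).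
have -> : (\int[mu]_q (G q)%:E = \int[mu]_(q in `[lo, hi]) (G q)%:E)%E.
  rewrite [RHS]integral_mkcond; apply: eq_integral => p _.
  rewrite /patch; case: ifPn => // /negP; rewrite inE /= in_itv /= => hp.
  by rewrite /G dE rate_weight_eq0 ?mul0r //; apply/negP.
have c1p : continuous (fun q => 1 - phi q).
  by move=> q; apply: cvgB; [exact: cvg_cst|exact: cphi].
have cG : continuous G.
  move=> q; rewrite /G.
  have c1 : {for q, continuous (fun q : R => w q / rate_mass)}.
    by apply: cvgMl; exact: continuous_rate_weight.
  have c3 := continuous_max (@cst_continuous _ _ (0 : R^o) q) (c1p q).
  by apply: cvgM; [exact: c1|exact: c3].
have iG := @continuous_integrable_itv G lo hi cG.
have -> : (\int[mu]_(q in `[lo, hi]) (G q)%:E = (\int[mu]_(q in `[lo, hi]) G q)%:E)%E.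
  by rewrite /Rintegral fineK //; apply: integrable_fin_num => //; exact: iG.
rewrite lee_fin.
have E : rate_int (fun q => 1 / rate_mass + - rate_mass^-1 * phi q) =
    1 - rate_int phi / rate_mass.
  by rewrite rate_int_affine //; field; rewrite gt_eqF.
apply: (@le_trans _ _ (1 - rate_int phi / rate_mass)).
  by rewrite lerD2l lerN2 ler_pdivrMr.
rewrite -E; apply: le_Rintegral => //.
  apply: continuous_integrable_itv; apply: continuous_rate_mul => q.
  apply: cvgD; first exact: cvg_cst.
  by apply: cvgMr; exact: cphi.
move=> q /=; rewrite in_itv /= => hq; rewrite /G dE.
have -> : w q * (1 / rate_mass + - rate_mass^-1 * phi q) = w q / rate_mass * (1 - phi q).
  by field; rewrite gt_eqF.
by apply: ler_wpM2l; [rewrite -dE|rewrite le_max lexx orbT].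
Qed.

End RateDistribution.

(** * Minimizing the error mass by linear minorants *)

Section Tangents.
Variable R : realType.
Implicit Types t y w M P Q v : R.

(* For p <= 1 and y <= t, the product y p is at least the affine function t p - (t - y) of p. *)
Lemma tangent_outer t y w M P Q : 0 < w -> 0 < M -> y <= t -> P <= 1 ->
  t / M / w * (P + y * Q) - (t - y) / (M * w) <= y / w / M * P + t / M / w * y * Q.
Proof.
move=> w0 M0 yt P1; have K0 : 0 <= (M * w)^-1 by rewrite invr_ge0 mulr_ge0 // ltW.
have -> : t / M / w * (P + y * Q) - (t - y) / (M * w) =
    t / M / w * y * Q + (M * w)^-1 * (t * P - (t - y)).
  by field; rewrite ?gt_eqF.
rewrite addrC lerD2r.
have -> : y / w / M * P = (M * w)^-1 * (y * P) by field; rewrite ?gt_eqF.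
by apply: ler_wpM2l => //; nra.
Qed.

(** The companion for [t <= y], where the cheapest choice is [p = 0]: from [0 <= p] follows
    [t p <= y p], with no correction. *)
Lemma tangent_inner t y w M P Q : 0 < w -> 0 < M -> t <= y -> 0 <= P ->
  t / M / w * (P + y * Q) <= y / w / M * P + t / M / w * y * Q.
Proof.
move=> w0 M0 ty P0; rewrite [_ * (P + _)]mulrDr [_ * (y * Q)]mulrA lerD2r.
apply: ler_wpM2r => //; rewrite [leRHS]mulrAC.
by rewrite ler_pM2r ?invr_gt0 // ler_pM2r ?invr_gt0.
Qed.

(** With [v = q (1 - q)], the factor [v] of Russo's formula cancels the density exactly in the term
    with [Q], whose sign is unknown. Only the nonnegative error term is weakened, from [1/v] to
    [1/M]. *)
Lemma weighted_gain t y w M P Q v : 0 < w -> 0 < M -> 0 < v -> M^-1 <= v^-1 -> 0 <= y -> 0 <= P ->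
  y / w / M * P + t / M / w * y * Q <= y / w / v * (P + t / M * (v * Q)).
Proof.
move=> w0 M0 v0 Mv y0 P0; rewrite [leRHS]mulrDr; apply: lerD.
  by apply: ler_wpM2r => //; apply: ler_wpM2l => //; rewrite divr_ge0 // ltW.
rewrite le_eqVlt; apply/orP; left; apply/eqP; field.
by rewrite ?gt_eqF.
Qed.

End Tangents.

Section RateGain.
Variables (R : realType) (rt : rates R).
Local Notation lo := (qmin rt).
Local Notation l1 := (q1 rt).
Local Notation l2 := (q2 rt).
Local Notation hi := (qmax rt).
Local Notation w1 := (l1 - lo).
Local Notation w2 := (hi - l2).
Local Notation Mx := (hi * (1 - lo)).
Local Notation w := (rate_weight rt).
Hypothesis ok : rates_ok rt.

(** A bathtub problem in dual form. If the means of [P] on the two ramps equal a common value [c],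
    errors are cheapest at the outer ends, where f is small: on length [c w1] next to qmin and
    [(1 - c) w2] next to qmax, at cost [c^2 w1 / 2 + (1 - c)^2 w2 / 2]. The minimum is at
    [c w1 = (1 - c) w2 = th], with value [th / 2]. The multiplier of the constraint is [th], hence
    the coefficient [th / Mx] of the derivative term; [s] is the slack of one round. *)
Lemma rate_gain (P : {poly R}) (g : R -> R) (s : R) :
  let th := w1 * w2 / (w1 + w2) in
  continuous g ->
  (forall q, lo <= q <= hi -> 0 <= P.[q] <= 1) ->
  (forall q, lo <= q <= hi -> th / Mx * (q * (1 - q) * P^`().[q]) - s <= g q) ->
  (forall q, lo <= q <= l1 -> P.[q] + th / Mx * (q * (1 - q) * P^`().[q]) - s <= g q) ->
  (forall q, l2 <= q <= hi -> 1 - P.[q] + th / Mx * (q * (1 - q) * P^`().[q]) - s <= g q) ->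
  th / (2 * Mx) - s * rate_mass rt <= rate_int rt g.
Proof.
move=> th cg P01 gmid glow ghigh.
have [v1 v2 Mx0] : [/\ 0 < w1, 0 < w2 & 0 < Mx].
  by case: ok => lo0 lol1 l12 l2hi hi1; split; [lra|lra|rewrite mulr_gt0 //; lra].
have v12 : 0 < w1 + w2 by rewrite addr_gt0.
have th0 : 0 < th by exact: divr_gt0 (mulr_gt0 v1 v2) v12.
have th1 : th < w1 by rewrite /th ltr_pdivrMr // ltr_pM2l // ltrDr.
have th2 : th < w2 by rewrite /th ltr_pdivrMr // (mulrC w1) ltr_pM2l // ltrDl.
pose c2 := th / Mx / w1; pose c3 := th / Mx / w2.
(* [H2], [H3] and [H4] integrate the terms with [P] and its derivative together, by the product
   rule; [A1] and [A5] integrate the tangent corrections on the outer parts of the ramps. *)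
pose H2 : {poly R} := c2%:P * (('X - lo%:P) * P).
pose A1 : {poly R} := ((Mx * w1)^-1)%:P * (th%:P * 'X - 2^-1%:P * ('X - lo%:P) ^+ 2).
pose H3 : {poly R} := (th / Mx)%:P * P.
pose H4 : {poly R} := (- c3)%:P * ((hi%:P - 'X) * (1%:P - P)).
pose A5 : {poly R} := ((Mx * w2)^-1)%:P * (th%:P * 'X + 2^-1%:P * (hi%:P - 'X) ^+ 2).
have D2 q : H2^`().[q] = c2 * (P.[q] + (q - lo) * P^`().[q]).
  by rewrite /H2 !poly.derivE !hornerE /=; ring.
have D1 q : A1^`().[q] = (th - (q - lo)) / (Mx * w1).
  by rewrite /A1 !poly.derivE !hornerE /= mulrC; congr (_ * _); field.
have D3 q : H3^`().[q] = th / Mx * P^`().[q] by rewrite /H3 !poly.derivE !hornerE.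
have D4 q : H4^`().[q] = c3 * ((1 - P.[q]) + (hi - q) * P^`().[q]).
  by rewrite /H4 !poly.derivE !hornerE /=; ring.
have D5 q : A5^`().[q] = (th - (hi - q)) / (Mx * w2).
  by rewrite /A5 !poly.derivE !hornerE /= mulrC; congr (_ * _); field.
have F1 q : A1.[q] = (th * q - (q - lo) ^+ 2 / 2) / (Mx * w1).
  by rewrite /A1 !hornerE /= mulrC; congr (_ * _); ring.
have F2 q : H2.[q] = c2 * ((q - lo) * P.[q]) by rewrite /H2 !hornerE.
have F3 q : H3.[q] = th / Mx * P.[q] by rewrite /H3 !hornerE.
have F4 q : H4.[q] = - c3 * ((hi - q) * (1 - P.[q])) by rewrite /H4 !hornerE.
have F5 q : A5.[q] = (th * q + (hi - q) ^+ 2 / 2) / (Mx * w2).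
  by rewrite /A5 !hornerE /= mulrC; congr (_ * _); ring.
clearbody H2 A1 H3 H4 A5.
(* All values of [P] at the cuts cancel. What survives is [th / Mx] from the telescoping terms,
   minus [th / (2 Mx)] from the corrections. *)
have total : th / (2 * Mx) =
    ((H2 - A1).[lo + th] - (H2 - A1).[lo]) + (H2.[l1] - H2.[lo + th]) + (H3.[l2] - H3.[l1]) +
    (H4.[hi - th] - H4.[l2]) + ((H4 - A5).[hi] - (H4 - A5).[hi - th]).
  rewrite !hornerD !hornerN !F1 !F2 !F3 !F4 !F5 /c2 /c3.
  move: v1 v2 Mx0; rewrite /th.
  set u := w1; set v := w2; set M := Mx => u0 v0 M0.
  by field; rewrite ?gt_eqF // addr_gt0.
have E2 : rate_int rt (fun q => s + 1 * g q) = s * rate_mass rt + rate_int rt g.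
  by rewrite (rate_int_affine ok) // mul1r.
have c1 : continuous (fun q : R => w q * (s + 1 * g q)).
  apply: (continuous_rate_mul ok) => q; apply: cvgD; first exact: cvg_cst.
  by apply: cvgMr; exact: cg.
have wg q a : lo <= q <= hi -> a - s <= g q -> w q * a <= w q * (s + 1 * g q).
  move=> hq h; apply: ler_wpM2l; first exact: (rate_weight_ge0 ok).
  by rewrite mul1r -lerBlDl.
have le_lo q : lo <= q <= l1 -> lo <= q <= hi.
  by case: ok => *; apply/andP; split; lra.
have le_hi q : l2 <= q <= hi -> lo <= q <= hi.
  by case: ok => *; apply/andP; split; lra.
have le_mid q : l1 <= q <= l2 -> lo <= q <= hi.
  by case: ok => *; apply/andP; split; lra.
have low q : lo <= q <= l1 -> (q - lo) / w1 / Mx * P.[q] + c2 * (q - lo) * P^`().[q] <=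
    w q * (s + 1 * g q).
  move=> hq; have hq' := le_lo q hq; apply: le_trans (wg q _ hq' (glow q hq)).
  have [qp /andP[h _]] := rate_inv_bounds ok hq'; have /andP[p0 _] := P01 q hq'.
  by rewrite (rate_weight_low ok) //; apply: weighted_gain; rewrite ?subr_ge0 //; case/andP: hq.
have high q : l2 <= q <= hi -> (hi - q) / w2 / Mx * (1 - P.[q]) + c3 * (hi - q) * P^`().[q] <=
    w q * (s + 1 * g q).
  move=> hq; have hq' := le_hi q hq; apply: le_trans (wg q _ hq' (ghigh q hq)).
  have [qp /andP[h _]] := rate_inv_bounds ok hq'; have /andP[_ p1] := P01 q hq'.
  by rewrite (rate_weight_high ok) //; apply: weighted_gain; rewrite ?subr_ge0 //; case/andP: hq.
have u1 : lo < lo + th by rewrite ltrDl.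
have u2 : lo + th < l1 by rewrite -ltrBrDl.
have u3 : l2 < hi - th by rewrite ltrBrDr -ltrBrDl.
have u4 : hi - th < hi by rewrite ltrBlDr ltrDl.
rewrite total lerBlDl -E2.
apply: (rate_int_pieces5 ok (u := lo + th) (v := hi - th) c1) => // q /andP[hq1 hq2].
- have hq : lo <= q <= l1 by rewrite hq1 (le_trans hq2 (ltW u2)).
  have /andP[p0 p1] := P01 q (le_lo q hq); apply: le_trans (low q hq).
  by rewrite derivB hornerD hornerN D1 D2; apply: tangent_outer; rewrite // lerBlDl.
- have hq : lo <= q <= l1 by rewrite (le_trans (ltW u1) hq1).
  have /andP[p0 p1] := P01 q (le_lo q hq); apply: le_trans (low q hq).
  by rewrite D2; apply: tangent_inner; rewrite // lerBrDl.
- have hq : l1 <= q <= l2 by rewrite hq1.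
  have [qp _] := rate_inv_bounds ok (le_mid q hq).
  apply: le_trans (wg q _ (le_mid q hq) (gmid q (le_mid q hq))); rewrite D3 (rate_weight_mid ok) //.
  by rewrite [leRHS]mulrCA mulKf // gt_eqF.
- have hq : l2 <= q <= hi by rewrite hq1 (le_trans hq2 (ltW u4)).
  have /andP[p0 p1] := P01 q (le_hi q hq); apply: le_trans (high q hq).
  by rewrite D4; apply: tangent_inner; rewrite ?subr_ge0 // lerBrDr -lerBrDl.
- have hq : l2 <= q <= hi by rewrite hq2 (le_trans (ltW u3) hq1).
  have /andP[p0 p1] := P01 q (le_hi q hq); apply: le_trans (high q hq).
  rewrite derivB hornerD hornerN D4 D5; apply: tangent_outer => //.
    by rewrite lerBlDr -lerBlDl.
  by rewrite lerBlDr lerDl.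
Qed.

End RateGain.

(** * The attacker *)

Lemma nth_sorted_down (P : pred nat) (s : seq nat) i :
  sorted leq s -> (forall m n, (m <= n)%N -> P n -> P m) ->
  (i < count P s)%N -> P (nth 0%N s i).
Proof.
move=> ss Pd ic; apply: contraLR ic => nP; rewrite -leqNgt.
rewrite -(cat_take_drop i s) count_cat.
rewrite (_ : count P (drop i s) = 0%N) ?addn0.
  by apply: leq_trans (count_size _ _) _; rewrite size_take_min geq_minl.
apply/eqP; rewrite -leqn0 leqNgt -has_count; apply/negP => /hasP[m mi Pm].
have [k ks mE] := nthP 0%N mi; move: ks; rewrite size_drop => ks.
move/negP: nP; apply; apply: Pd Pm; rewrite -mE nth_drop.
have is_ : (i + k < size s)%N by rewrite -ltn_subRL.
apply: (sorted_leq_nth leq_trans leqnn 0%N ss); rewrite ?inE //.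
  exact: leq_ltn_trans (leq_addr _ _) is_.
exact: leq_addr.
Qed.

Lemma nth_sorted_up (P : pred nat) (s : seq nat) i :
  sorted leq s -> (forall m n, (m <= n)%N -> P m -> P n) ->
  (i < size s)%N -> (size s <= i + count P s)%N -> P (nth 0%N s i).
Proof.
move=> ss Pu is_ ic; apply: contraLR ic => nP; rewrite -ltnNge.
rewrite -{1}(cat_take_drop i.+1 s) count_cat.
rewrite (_ : count P (take i.+1 s) = 0%N) ?add0n.
  have : (count P (drop i.+1 s) <= size s - i.+1)%N.
    by rewrite -size_drop count_size.
  by move=> h; rewrite -ltn_subRL; apply: leq_ltn_trans h _; rewrite subnS prednK ?subn_gt0.
apply/eqP; rewrite -leqn0 leqNgt -has_count; apply/negP => /hasP[m mi Pm].
have [k ks mE] := nthP 0%N mi; move: ks; rewrite size_take_min leq_min => /andP[ki ks].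
move/negP: nP; apply; apply: Pu Pm; rewrite -mE nth_take //.
by apply: (sorted_leq_nth leq_trans leqnn 0%N ss); rewrite ?inE.
Qed.

(** More than half of the list lies in the interval, so the entries below [lo] do not reach the
    lower middle position [a], nor those above [hi] the upper one [b]. *)
Lemma median_bounds (R : realType) (s : seq nat) (lo hi : R) :
  (size s < 2 * count (fun c : nat => (lo <= c%:R <= hi)%R) s)%N -> lo <= median R s <= hi.
Proof.
set P := (fun c : nat => _) => hc; rewrite /median.
set s' := sort leq s; have ss : sorted leq s' by exact: sort_sorted leq_total s.
have szs : size s' = size s by rewrite size_sort.
have ct Q : count Q s' = count Q s by apply/permP; rewrite perm_sort.
have c1 : (count P s <= count (fun c : nat => (lo <= c%:R)%R) s')%N.
  by rewrite ct; apply: sub_count => c /andP[].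
have c2 : (count P s <= count (fun c : nat => (c%:R <= hi)%R) s')%N.
  by rewrite ct; apply: sub_count => c /andP[].
have cs : (count P s <= size s)%N by exact: count_size.
have szE := odd_double_half (size s).
set a := (size s).-1./2; set b := (size s)./2.
have ab : (a <= b)%N by apply: half_leq; exact: leq_pred.
have s0 : (0 < size s)%N by case: (size s) hc cs => // hc cs; move: hc; rewrite ltnNge; case: (count P s) cs.
have bs : (b < size s)%N by rewrite /b -divn2 ltn_Pdiv.
have bc : (b < count P s)%N by move: hc szE; rewrite -/b mul2n -!addnn => *; lia.
have aE : (size s <= a.*2.+2)%N.
  have := odd_double_half (size s).-1; rewrite -/a; case: (odd _) => /=; lia.
have ac : (size s <= a + count P s)%N by lia.
have down x : (x <= b)%N -> (nth 0%N s' x)%:R <= hi.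
  move=> xb; apply: (@nth_sorted_down (fun c : nat => (c%:R <= hi)%R)) => //.
    by move=> m n mn; apply: le_trans; rewrite ler_nat.
  by apply: leq_ltn_trans xb _; exact: leq_trans bc c2.
have up x : (a <= x)%N -> (x <= b)%N -> lo <= (nth 0%N s' x)%:R.
  move=> ax xb; apply: (@nth_sorted_up (fun c : nat => (lo <= c%:R)%R)) => //.
  - by move=> m n mn /le_trans; apply; rewrite ler_nat.
  - by rewrite szs; exact: leq_ltn_trans xb bs.
  - by rewrite szs; apply: leq_trans ac _; apply: leq_add.
have h1 := down a ab; have h2 := down b (leqnn _).
have h3 := up a (leqnn _) ab; have h4 := up b ab (leqnn _).
by apply/andP; split; [rewrite ler_pdivlMr // | rewrite ler_pdivrMr //]; lra.
Qed.

Section Attacker.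
Variables (R : realType) (U : finType) (r : nat) (L : {set U}).
Let thr : R := 16 * Num.sqrt (r%:R * ln (r%:R * #|U|%:R)).
Hypothesis Lhalf : (2 * #|L| < #|U|)%N.

(** The elements outside L are more than half of the ground set and all of them are still unmasked,
    so they form a strict majority of the list whose median is taken. *)
Lemma median_outside (C : U -> nat) (M : {set U}) (lo hi : R) : M \subset L ->
  (forall y, y \notin L -> lo <= (C y)%:R <= hi) ->
  lo <= median R [seq C y | y <- enum (~: M)] <= hi.
Proof.
move=> ML hC; apply: median_bounds; rewrite size_map -cardE count_map.
apply: (@leq_ltn_trans #|U|); first exact: max_card.
set k := count _ _; have hk : (#|~: L| <= k)%N.
  apply: (@leq_trans (count [in ~: L] (enum (~: M)))); last first.
    by apply: sub_count => y; rewrite inE => /hC.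
  rewrite -size_filter cardE; apply: uniq_leq_size; first exact: enum_uniq.
  move=> y; rewrite mem_enum mem_filter mem_enum => yL; rewrite yL /=.
  by move: yL; rewrite !inE; apply: contra; apply: (fintype.subsetP ML).
have := cardsC L; have := Lhalf; lia.
Qed.

(** Within a round the median is taken over partly updated counters. [c0] holds the counters at the
    start of the round: visited ones may have grown by 1, those still in [s] have not, so the median
    stays between [lo] and [hi + 1]. Hence an element outside L stays below the bar, and an element
    that passes its test unmasked has its counter below [hi + 1 + thr]. *)
Lemma foldl_visit (z : bool) (c0 : U -> nat) (lo hi : R) s (st : attacker U) :
  (forall y, y \notin L -> lo <= (c0 y)%:R <= hi) -> hi + 1 < lo + thr ->
  uniq s -> Defs.mask st \subset L ->
  (forall y, (c0 y <= counter st y <= c0 y + (y \notin s))%N) ->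
  let st' := foldl (visit R r z) st s in
  [/\ forall y, counter st' y = (counter st y + (z && (y \in s)))%N,
      Defs.mask st \subset Defs.mask st', Defs.mask st' \subset L &
      forall x, x \in s -> x \notin Defs.mask st' -> (counter st' x)%:R < hi + 1 + thr].
Proof.
move=> hc0 hthr; elim: s st => [|x s IH] st /=.
  move=> _ ML _; split => // y; by rewrite andbF addn0.
case/andP=> xs us ML hst; set st1 := visit R r z st x.
pose C y := (counter st y + (z && (y == x)))%N.
have hC y : (c0 y <= C y <= c0 y + (y \notin s))%N.
  have := hst y; rewrite /C inE; have [->|yx] /= := eqVneq y x.
    by rewrite xs; case: z {IH st1 C} => /=; lia.
  by rewrite andbF addn0.
have hC' y : y \notin L -> lo <= (C y)%:R <= hi + 1.
  move=> /hc0 /andP[h1 h2]; have /andP[h3 h4] := hC y.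
  rewrite (le_trans h1) ?ler_nat //=; apply: (@le_trans _ _ ((c0 y)%:R + 1)); last by rewrite lerD2r.
  by rewrite natr1 ler_nat; apply: leq_trans h4 _; rewrite -addn1 leq_add2l leq_b1.
have /andP[med1 med2] := median_outside ML hC'.
have C1 : counter st1 = C by [].
have M1 : Defs.mask st1 = if median R [seq C y | y <- enum (~: Defs.mask st)] + thr <= (C x)%:R
   then x |: Defs.mask st else Defs.mask st by [].
have ML1 : Defs.mask st1 \subset L.
  rewrite M1; case: ifP => // hx; rewrite finset.subUset ML andbT finset.sub1set.
  apply: contraTT hx => xL; rewrite -ltNge.
  by have /andP[_ h] := hC' x xL; lra.
have Ms : Defs.mask st \subset Defs.mask st1 by rewrite M1; case: ifP => // _; exact: finset.subsetUr.
have [i1 i2 i3 i4] := IH st1 us ML1 hC.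
split => //.
- by move=> y; rewrite i1 C1 /C inE -addnA; congr (_ + _)%N; case: eqVneq => [->|]; rewrite ?(negbTE xs) ?andbT ?andbF ?addn0 // orbF.
- exact: fintype.subset_trans Ms i2.
- move=> y; rewrite inE => /orP[/eqP->|ys]; last exact: i4.
  move=> xM; rewrite i1 (negbTE xs) andbF addn0 C1.
  have : x \notin Defs.mask st1 by apply: contra xM; apply: (fintype.subsetP i2).
  rewrite M1; case: ifPn => [_|]; first by rewrite finset.setU11.
  by rewrite -ltNge => h _; lra.
Qed.

Lemma update_spec (z : bool) (lo hi : R) (W : {set U}) (st : attacker U) :
  (forall y, y \notin L -> lo <= (counter st y)%:R <= hi) -> hi + 1 < lo + thr ->
  Defs.mask st \subset L ->
  let st' := update R r st W z in
  [/\ forall y, counter st' y = (counter st y + (z && (y \in W :\: Defs.mask st)))%N,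
      Defs.mask st \subset Defs.mask st', Defs.mask st' \subset L &
      forall x, x \in W :\: Defs.mask st -> x \notin Defs.mask st' -> (counter st' x)%:R < hi + 1 + thr].
Proof.
move=> h1 h2 h3; rewrite /update.
have h4 y : (counter st y <= counter st y <= counter st y + (y \notin enum (W :\: Defs.mask st)))%N.
  by rewrite leqnn leq_addr.
have [i1 i2 i3 i4] := @foldl_visit z _ _ _ _ _ h1 h2 (enum_uniq _) h3 h4.
by split => // [y|x]; [rewrite i1 mem_enum|move=> xW; apply: i4; rewrite mem_enum].
Qed.

(* The attacker together with the centred scores, which freeze once an element enters the
   mask, the sum of the rates of the rounds answered 1, and the number of errors. *)
Record ledger := Ledger { atk : attacker U; adv : U -> R; base : R; errs : nat }.

Variables (A B : R).

Definition ledger0 : ledger := Ledger (attacker0 U) (fun=> 0) 0 0.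

Definition ledger_step (a : ledger) (q : R) (W : {set U}) (z : bool) : ledger :=
  Ledger (update R r (atk a) W z)
    (fun x => adv a x + (if x \in Defs.mask (atk a) then 0 else z%:R * dev q x W))
    (base a + q * z%:R)
    (errs a + incorrect A B (W :|: Defs.mask (atk a)) z).

(** The counter is tied to the score only while [x] is unmasked. The extra 1 for a masked element is
    the increment of the round in which it entered the mask. *)
Definition ledger_inv (b : R) (a : ledger) : Prop :=
  [/\ Defs.mask (atk a) \subset L,
      forall x, x \notin Defs.mask (atk a) -> (counter (atk a) x)%:R = base a + adv a x &
      forall x, x \in L -> adv a x <= b + (x \in Defs.mask (atk a))%:R].

Lemma ledger_inv0 (b : R) : 0 <= b -> ledger_inv b ledger0.
Proof.
move=> b0; split => /=; first exact: finset.sub0set.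
  by move=> x _; rewrite addr0.
by move=> x _; rewrite inE addr0.
Qed.

Lemma ledger_inv_step (D : R) (a : ledger) q W z : 0 <= q <= 1 -> 2 * D + 1 < thr ->
  (forall x, x \notin L -> `|adv a x| <= D) ->
  ledger_inv (D + 1 + thr) a -> ledger_inv (D + 1 + thr) (ledger_step a q W z).
Proof.
move=> /andP[q0 q1] hD hadv [ML hC hL].
have hlo y : y \notin L -> base a - D <= (counter (atk a) y)%:R <= base a + D.
  move=> yL; have yM : y \notin Defs.mask (atk a) by apply: contra yL; apply: (fintype.subsetP ML).
  by rewrite hC //; have := hadv y yL; rewrite ler_norml => /andP[? ?]; apply/andP; split; lra.
have [i1 i2 i3 i4] := update_spec z W hlo ltac:(lra) ML.
have cons x : x \notin Defs.mask (atk a) ->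
    (counter (update R r (atk a) W z) x)%:R = base a + q * z%:R + (adv a x + z%:R * dev q x W).
  move=> xM; rewrite i1 natrD hC // inE xM /= /dev.
  by case: z {i1 i2 i3 i4}; case: (x \in W); rewrite /= ?mulr1n ?mulr0n; ring.
split => //=.
  move=> x xM'; have xM : x \notin Defs.mask (atk a) by apply: contra xM'; apply: (fintype.subsetP i2).
  by rewrite cons // (negbTE xM).
move=> x xL; have hx := hL x xL.
have [xM|xM] := boolP (x \in Defs.mask (atk a)).
  by rewrite addr0 (fintype.subsetP i2 _ xM); move: hx; rewrite xM.
move: hx; rewrite (negbTE xM) mulr0n addr0 => hx.
have d1 : z%:R * dev q x W <= 1.
  by rewrite /dev; case: z {i1 i2 i3 i4 cons}; case: (x \in W); rewrite /= ?mulr1n ?mulr0n; lra.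
have [xM'|xM'] := boolP (x \in Defs.mask (update R r (atk a) W z)).
  by rewrite mulr1n; lra.
rewrite mulr0n addr0.
(* The score can rise only if [x] lies in [W], and then the attacker tests [x] in this round;
   surviving the test bounds the counter, hence the score. *)
have [xW|xW] := boolP (x \in W); last first.
  suff : z%:R * dev q x W <= 0 by lra.
  by rewrite /dev (negbTE xW) mulr0n sub0r mulrN oppr_le0 mulr_ge0.
have := i4 x _ xM'; rewrite inE xM xW => /(_ isT).
rewrite cons // => h.
have qz : 0 <= q * z%:R by rewrite mulr_ge0.
lra.
Qed.

End Attacker.

(** * One round of the attack *)

(** Inverting [expR (- y) >= 1 - y] gives [expR y <= 1 / (1 - y)], and [(1 - y) (1 + y + 2 y^2) = 1
    + y^2 (1 - 2 y)]. *)
Lemma expR_quadratic (R : realType) (y : R) : y <= 1 / 2 -> expR y <= 1 + y + 2 * y ^+ 2.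
Proof.
move=> y2; have h := expR_ge1Dx (- y).
have p1 : 0 < 1 + - y by lra.
have -> : expR y = (expR (- y))^-1 by rewrite expRN invrK.
apply: (@le_trans _ _ (1 + - y)^-1); first by rewrite lef_pV2 ?posrE ?expR_gt0.
rewrite -[leLHS]mul1r ler_pdivrMr //.
have : 0 <= y ^+ 2 * (1 - 2 * y) by rewrite mulr_ge0 ?sqr_ge0 //; lra.
by rewrite expr2 => ?; nra.
Qed.

Section Continuity.
Variables (R : realType) (U : finType).

Lemma continuous_bern (W : {set U}) : continuous (fun q : R => bern q W).
Proof.
have -> : (fun q : R => bern q W) = horner ('X^#|W| * (1 - 'X) ^+ (#|U| - #|W|)).
  by apply/funext => q; rewrite !hornerE bern_card.
by move=> q; exact: continuous_horner.
Qed.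

Lemma continuous_fsum (I : Type) (s : seq I) (P : pred I) (f : I -> R -> R) :
  (forall i, continuous (f i)) -> continuous (fun q => \sum_(i <- s | P i) f i q).
Proof.
move=> cf; elim: s => [|i s IH] q.
  by under eq_fun do rewrite big_nil; exact: cst_continuous.
under eq_fun do rewrite big_cons.
by case: (P i); [apply: cvgD; [exact: cf|exact: IH]|exact: IH].
Qed.

Lemma continuous_devs (A W : {set U}) : continuous (fun q : R => devs A q W).
Proof.
rewrite /devs; apply: continuous_fsum => x q; rewrite /dev.
by apply: cvgB => //; exact: cvg_cst.
Qed.

Lemma continuous_dev x (W : {set U}) : continuous (fun q : R => dev q x W).
Proof. by move=> q; rewrite /dev; apply: cvgB => //; exact: cvg_cst. Qed.

Lemma continuous_expRM (c : R) (f : R -> R) : continuous f ->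
  continuous (fun q => expR (c * f q)).
Proof.
move=> cf q; apply: (@continuous_comp _ _ _ (fun q => c * f q) expR); last exact: continuous_expR.
by apply: cvgMr; exact: cf.
Qed.

Definition mean (p : {set U} -> R) (G : {set U} -> bool -> R) (q : R) : R :=
  \sum_(W : {set U}) bern q W * (p W * G W true + (1 - p W) * G W false).

Lemma continuous_mean p (G : R -> {set U} -> bool -> R) :
  (forall W z, continuous (fun q => G q W z)) -> continuous (fun q => mean p (G q) q).
Proof.
move=> cG; rewrite /mean; apply: continuous_fsum => W q.
apply: cvgM; first exact: continuous_bern.
by apply: cvgD; apply: cvgMr; exact: cG.
Qed.

Lemma le_mean p (F G : {set U} -> bool -> R) q : 0 <= q <= 1 -> (forall W, 0 <= p W <= 1) ->
  (forall W z, F W z <= G W z) -> mean p F q <= mean p G q.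
Proof.
move=> q01 p01 FG; apply: ler_sum => W _; apply: ler_wpM2l; first exact: bern_ge0.
have /andP[h0 h1] := p01 W.
by apply: lerD; apply: ler_wpM2l => //; rewrite subr_ge0.
Qed.

Lemma mean_affine p (a b : R) (G : {set U} -> bool -> R) q :
  mean p (fun W z => a + b * G W z) q = a + b * mean p G q.
Proof.
have -> : a + b * mean p G q = (\sum_(W : {set U}) bern q W) * a + b * mean p G q.
  by rewrite sum_bern mul1r.
rewrite /mean mulr_suml mulr_sumr -big_split /=.
by apply: eq_bigr => W _; ring.
Qed.

End Continuity.

Section Round.
Variables (R : realType) (U : finType) (L M : {set U}) (p p' : {set U} -> R) (d : R).
Variables (A B : R).
Let pL W := p' (W :&: (L :\: M)).

(* The law p of the bit is close to a law which only sees the part of W in L \ M. *)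
Definition shadowed q := [/\ 0 <= q <= 1, forall W, 0 <= p W <= 1,
  forall W, 0 <= p' W <= 1 & \sum_(W : {set U}) bern q W * `|p W - pL W| <= d].

(** The shadow [pL] does not see [x], so its correlation with [x] is exactly 0; passing from [p] to
    [pL] costs [d]. *)
Lemma mean_dev_outside q x : shadowed q -> x \notin L ->
  `|\sum_(W : {set U}) bern q W * (p W * dev q x W)| <= d.
Proof.
move=> [q01 p01 p01' pd] xL.
have := sum_bern_dist q01 ler01 pd (fun W => dev_norm x W q01).
rewrite mul1r (@sum_bern_dev _ _ q x pL) ?subr0 // => W.
rewrite /pL; congr p'; apply/setP => y; rewrite !inE; have [->|//] := eqVneq y x.
by rewrite (negbTE xL) !andbF.
Qed.

Lemma mean_exp_outside q x c : shadowed q -> x \notin L -> `|c| <= 1 / 2 ->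
  mean p (fun W z => expR (c * (z%:R * dev q x W))) q <= expR (`|c| * d + 2 * c ^+ 2).
Proof.
move=> sh xL c2; have [q01 p01 _ _] := sh.
apply: le_trans (expR_ge1Dx _).
have h := mean_dev_outside sh xL.
apply: (@le_trans _ _ (1 + 2 * c ^+ 2 + c * \sum_(W : {set U}) bern q W * (p W * dev q x W))).
  apply: (@le_trans _ _ (mean p (fun W z => 1 + 2 * c ^+ 2 + c * (z%:R * dev q x W)) q)).
    apply: le_mean => // W z; have := dev_norm x W q01; set e := dev q x W => e1.
    have ze1 : `|z%:R * e| <= 1 by case: z; rewrite ?mul1r ?mul0r ?normr0.
    have cze : `|c * (z%:R * e)| <= `|c| by rewrite normrM ler_piMr.
    apply: (le_trans (expR_quadratic _)); first by apply: le_trans (ler_norm _) _; exact: le_trans cze c2.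
    have : (c * (z%:R * e)) ^+ 2 <= c ^+ 2.
      by rewrite -[leLHS]real_normK ?num_real // -[leRHS]real_normK ?num_real // lerXn2r ?nnegrE.
    lra.
  rewrite mean_affine /mean lerD2l le_eqVlt; apply/orP; left; apply/eqP; congr (_ * _).
  by apply: eq_bigr => W _; rewrite mul1r mul0r mulr0 addr0.
have : c * \sum_(W : {set U}) bern q W * (p W * dev q x W) <= `|c| * d.
  by apply: le_trans (ler_norm _) _; rewrite normrM ler_wpM2l.
lra.
Qed.

(** The increment in one round of the number of errors plus [k] times the sum of the scores in L. *)
Definition gain (k q : R) (W : {set U}) (z : bool) : R :=
  (incorrect A B (W :|: M) z)%:R + k * (z%:R * devs (L :\: M) q W).

Lemma shadow_poly q : shadowed q -> 0 <= (bern_poly pL).[q] <= 1.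
Proof.
move=> [q01 _ p01' _]; rewrite bern_polyE; apply/andP; split.
  by apply: sumr_ge0 => W _; rewrite mulr_ge0 ?bern_ge0 //; have /andP[] := p01' (W :&: (L :\: M)).
rewrite -(sum_bern U q); apply: ler_sum => W _.
by rewrite -[leRHS]mulr1 ler_wpM2l ?bern_ge0 //; have /andP[] := p01' (W :&: (L :\: M)).
Qed.

Lemma mean_gainE k q : mean p (gain k q) q =
  \sum_(W : {set U}) bern q W * (p W * (incorrect A B (W :|: M) true)%:R +
     (1 - p W) * (incorrect A B (W :|: M) false)%:R) +
  k * \sum_(W : {set U}) bern q W * (p W * devs (L :\: M) q W).
Proof.
rewrite /mean mulr_sumr -big_split /=; apply: eq_bigr => W _.
by rewrite /gain mul1r mul0r mulr0 addr0; ring.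
Qed.

Lemma mean_devs_ge k q : shadowed q -> 0 <= k ->
  k * (q * (1 - q) * (bern_poly pL)^`().[q]) - k * (#|L|%:R * d) <=
  k * \sum_(W : {set U}) bern q W * (p W * devs (L :\: M) q W).
Proof.
move=> [q01 p01 p01' pd] k0; rewrite -mulrBr ler_wpM2l //.
have c0 : 0 <= #|L|%:R :> R by rewrite ler0n.
have nm W : `|devs (L :\: M) q W| <= #|L|%:R.
  apply: le_trans (devs_norm _ _ q01) _; rewrite ler_nat; apply: subset_leq_card.
  exact: finset.subsetDl.
have := sum_bern_dist q01 c0 pd nm.
rewrite russo_formula (@sum_bern_devs _ _ [set: U] (L :\: M)) ?finset.subsetT //.
  by rewrite ler_norml => /andP[h _]; lra.
by move=> W; rewrite /pL -finset.setIA finset.setIid.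
Qed.

Lemma mean_incorrect_ge0 q : shadowed q ->
  0 <= \sum_(W : {set U}) bern q W * (p W * (incorrect A B (W :|: M) true)%:R +
     (1 - p W) * (incorrect A B (W :|: M) false)%:R).
Proof.
move=> [q01 p01 _ _]; apply: sumr_ge0 => W _; have /andP[h0 h1] := p01 W.
by rewrite mulr_ge0 ?bern_ge0 // addr_ge0 // mulr_ge0 // subr_ge0.
Qed.

Lemma mean_shadow q : shadowed q ->
  `|\sum_(W : {set U}) bern q W * p W - (bern_poly pL).[q]| <= d.
Proof.
move=> [q01 _ _ pd]; rewrite bern_polyE.
have := @sum_bern_dist _ _ q d 1 p pL (fun=> 1) q01 ler01 pd.
rewrite mul1r; have e (f : {set U} -> R) : \sum_(W : {set U}) bern q W * (f W * 1) = \sum_(W : {set U}) bern q W * f W.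
  by apply: eq_bigr => W _; rewrite mulr1.
by rewrite !e; apply => W; rewrite normr1.
Qed.

Lemma mean_gain_mid k q : shadowed q -> 0 <= k ->
  k * (q * (1 - q) * (bern_poly pL)^`().[q]) - k * (#|L|%:R * d) <= mean p (gain k q) q.
Proof.
move=> sh k0; rewrite mean_gainE.
have := mean_devs_ge sh k0; have := mean_incorrect_ge0 sh; lra.
Qed.

(** At a low rate the query has size at most [A], up to an exceptional probability [#|U| / s^2] by
    Chebyshev, and then every answer 1 is an error: the error probability is nearly the probability
    of the answer 1. *)
Lemma mean_gain_low k q s : shadowed q -> 0 <= k -> 0 < s ->
  (forall W, A < #|W :|: M|%:R -> s <= `|devs [set: U] q W|) ->
  (bern_poly pL).[q] + k * (q * (1 - q) * (bern_poly pL)^`().[q]) -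
    (k * (#|L|%:R * d) + d + #|U|%:R / s ^+ 2) <= mean p (gain k q) q.
Proof.
move=> sh k0 s0 hs; rewrite mean_gainE.
have h1 := mean_devs_ge sh k0; have := mean_shadow sh; rewrite ler_norml => /andP[h2 h3].
have [q01 p01 _ _] := sh.
have ch := @chebyshev_bern _ _ q s (fun W => 1 - (#|W :|: M|%:R <= A)%R%:R) q01 s0.
have {}ch : \sum_(W : {set U}) bern q W * (1 - (#|W :|: M|%:R <= A)%R%:R) <= #|U|%:R / s ^+ 2.
  apply: ch => W; first by rewrite lerBlDr lerDl.
  have [_|h _] := leP (#|W :|: M|%:R) A; last exact: hs.
  by rewrite subrr ltxx.
suff : \sum_(W : {set U}) bern q W * p W -
  \sum_(W : {set U}) bern q W * (1 - (#|W :|: M|%:R <= A)%R%:R) <=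
  \sum_(W : {set U}) bern q W * (p W * (incorrect A B (W :|: M) true)%:R +
     (1 - p W) * (incorrect A B (W :|: M) false)%:R) by lra.
rewrite -sumrB; apply: ler_sum => W _; rewrite -mulrBr ler_wpM2l ?bern_ge0 //.
have /andP[p0 p1] := p01 W.
rewrite /incorrect !andbT !andbF orbF /=.
have : 0 <= (1 - p W) * ((B <= #|W :|: M|%:R)%R%:R) by rewrite mulr_ge0 // subr_ge0.
case: (#|W :|: M|%:R <= A) => /=; case: (B <= _) => /=; rewrite ?mulr1n ?mulr0n; lra.
Qed.

Lemma mean_gain_high k q s : shadowed q -> 0 <= k -> 0 < s ->
  (forall W, #|W :|: M|%:R < B -> s <= `|devs [set: U] q W|) ->
  1 - (bern_poly pL).[q] + k * (q * (1 - q) * (bern_poly pL)^`().[q]) -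
    (k * (#|L|%:R * d) + d + #|U|%:R / s ^+ 2) <= mean p (gain k q) q.
Proof.
move=> sh k0 s0 hs; rewrite mean_gainE.
have h1 := mean_devs_ge sh k0; have := mean_shadow sh; rewrite ler_norml => /andP[h2 h3].
have [q01 p01 _ _] := sh.
have ch := @chebyshev_bern _ _ q s (fun W => 1 - (B <= #|W :|: M|%:R)%R%:R) q01 s0.
have {}ch : \sum_(W : {set U}) bern q W * (1 - (B <= #|W :|: M|%:R)%R%:R) <= #|U|%:R / s ^+ 2.
  apply: ch => W; first by rewrite lerBlDr lerDl.
  have [_|h _] := leP B (#|W :|: M|%:R); last exact: hs.
  by rewrite subrr ltxx.
suff : 1 - \sum_(W : {set U}) bern q W * p W -
  \sum_(W : {set U}) bern q W * (1 - (B <= #|W :|: M|%:R)%R%:R) <=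
  \sum_(W : {set U}) bern q W * (p W * (incorrect A B (W :|: M) true)%:R +
     (1 - p W) * (incorrect A B (W :|: M) false)%:R) by lra.
rewrite -[X in X - _ - _](sum_bern U q) -!sumrB; apply: ler_sum => W _.
rewrite -[X in X - _ - _]mulr1 -!mulrBr ler_wpM2l ?bern_ge0 //.
have /andP[p0 p1] := p01 W.
rewrite /incorrect !andbT !andbF orbF /=.
have : 0 <= p W * ((#|W :|: M|%:R <= A)%R%:R) by rewrite mulr_ge0.
case: (#|W :|: M|%:R <= A) => /=; case: (B <= _) => /=; rewrite ?mulr1n ?mulr0n; lra.
Qed.

Lemma gain_norm k q W z : 0 <= q <= 1 -> 0 <= k -> `|gain k q W z| <= 1 + k * #|L|%:R.
Proof.
move=> q01 k0; apply: le_trans (ler_normD _ _) _; apply: lerD.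
  by case: incorrect; rewrite ?normr1 ?normr0.
rewrite normrM ger0_norm // ler_wpM2l //.
apply: (@le_trans _ _ #|L :\: M|%:R); last by rewrite ler_nat subset_leq_card // finset.subsetDl.
by case: z; rewrite ?mul1r ?mul0r ?normr0 // devs_norm.
Qed.

Lemma mean_exp_gain k m q T : shadowed q -> 0 <= k -> 1 + k * #|L|%:R <= T ->
  0 <= m -> m * T <= 1 / 2 ->
  mean p (fun W z => expR (- m * gain k q W z)) q <= 1 + 2 * (m * T) ^+ 2 - m * mean p (gain k q) q.
Proof.
move=> [q01 p01 _ _] k0 kT m0 mT.
have -> : 1 + 2 * (m * T) ^+ 2 - m * mean p (gain k q) q =
  mean p (fun W z => (1 + 2 * (m * T) ^+ 2) + (- m) * gain k q W z) q.
  by rewrite mean_affine mulNr.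
apply: le_mean => // W z.
have g1 : `|gain k q W z| <= T by apply: le_trans kT; exact: gain_norm.
have g2 : `|- m * gain k q W z| <= m * T by rewrite normrM normrN (ger0_norm m0) ler_wpM2l.
apply: (le_trans (expR_quadratic _)); first by apply: le_trans (ler_norm _) _; exact: le_trans g2 mT.
have : (- m * gain k q W z) ^+ 2 <= (m * T) ^+ 2.
  rewrite -[leLHS]real_normK ?num_real // lerXn2r ?nnegrE //.
  by apply: le_trans g2.
lra.
Qed.

End Round.

(** * Transcripts *)

Lemma probability_Rintegral01 (R : realType) d (X : measurableType d) (P : probability X R)
    (f : X -> R) : measurable_fun setT f -> (forall x, 0 <= f x <= 1) ->
  P.-integrable setT (EFin \o f) /\ 0 <= \int[P]_x f x <= 1.
Proof.
move=> mf f01.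
have intf : P.-integrable setT (EFin \o f).
  apply: measurable_bounded_integrable => //.
    by rewrite -ge0_fin_numE //; exact: fin_num_measure.
  exists 1; split => // M M1 x _; have /andP[h0 h1] := f01 x.
  by rewrite /= ger0_norm // (le_trans h1) // ltW.
split => //; apply/andP; split.
  by apply: Rintegral_ge0 => x _; have /andP[] := f01 x.
have -> : 1 = \int[P]_x (cst 1 x) :> R.
  by rewrite Rintegral_cst // (_ : fine _ = 1) ?mulr1 //; exact: congr1 (probability_setT P).
apply: le_Rintegral => //; first exact: finite_measure_integrable_cst.
by move=> x _; have /andP[] := f01 x.
Qed.

Lemma prob_kernel_bool_ge (R : realType) d (T : measurableType d) (k : R.-pker T ~> bool)
    (s : T) (F : bool -> \bar R) (psi : bool -> R) :
  (forall z, 0 <= psi z) -> (forall z, ((psi z)%:E <= F z)%E) ->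
  let f := fine (k s [set true]%classic) in
  0 <= f <= 1 /\ ((f * psi true + (1 - f) * psi false)%:E <= \int[k s]_z F z)%E.
Proof.
move=> psi0 psiF f.
have kT : k s setT = 1%E by exact: prob_kernel.
have mtrue : measurable ([set true]%classic : set bool) by [].
have mfalse : measurable ([set false]%classic : set bool) by [].
have k1 : (k s [set true]%classic <= 1)%E.
  by rewrite -kT; apply: le_measure; rewrite ?inE.
have kfin : k s [set true]%classic \is a fin_num.
  by rewrite ge0_fin_numE // (le_lt_trans k1) ?ltry.
have kf : k s [set true]%classic = f%:E by rewrite /f fineK.
have f01 : 0 <= f <= 1 by rewrite -!lee_fin -kf measure_ge0 k1.
split => //.
have TU : [set: bool]%classic = ([set true] `|` [set false])%classic.
  by apply/seteqP; split => // -[] _; [left|right].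
have disj : [disjoint [set true] & [set false]]%classic.
  by apply/disj_setPS => z [/= ->].
have kf0 : k s [set false]%classic = (1 - f)%:E.
  have k0 : k s [set false]%classic \is a fin_num.
    rewrite ge0_fin_numE // (@le_lt_trans _ _ 1%E) ?ltry //.
    by rewrite -kT; apply: le_measure; rewrite ?inE.
  have : (k s [set true]%classic + k s [set false]%classic = 1)%E.
    by rewrite -kT TU measureU //; apply/seteqP; split=> z // [/= ->].
  rewrite kf -(fineK k0) -EFinD => -[h]; congr (_%:E); move: h => <-; ring.
apply: (@le_trans _ _ (\int[k s]_z (psi z)%:E)%E); last first.
  by apply: ge0_le_lower_integral => // z; rewrite lee_fin.
rewrite TU ge0_integral_setU //=; last by move=> z _; rewrite lee_fin.
have I b : (\int[k s]_(z in [set b]) (psi z)%:E = (psi b)%:E * k s [set b]%classic)%E.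
  rewrite (eq_integral (cst (psi b)%:E)) ?integral_cst // => z.
  by rewrite inE => /= ->.
by rewrite !I kf kf0 -!EFinM -EFinD lee_fin mulrC lerD2l mulrC.
Qed.

Section Transcript.
Variables (R : realType) (U : finType) (dX : measure_display) (X : measurableType dX)
  (dS : measure_display) (Sg : measurableType dS) (S : {set U} -> X -> Sg)
  (Aux : {set U} -> {set U} -> probability X R) (rt : rates R) (qr : responder R U X Sg).
Hypothesis mS : forall V : {set U}, measurable_fun setT (S V).
Hypothesis ok : rates_ok rt.

Definition resp_at t (h : t.-tuple (round R U X)) (s : Sg) : R :=
  fine (qr t (h, s) [set true]%classic).

Definition resp t (h : t.-tuple (round R U X)) (M W : {set U}) : R :=
  \int[Aux M (W :\: M)]_x resp_at h (S (W :|: M) x).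

Lemma measurable_resp_at t (h : t.-tuple (round R U X)) : measurable_fun setT (resp_at h).
Proof.
have := measurable_kernel (qr t) [set true]%classic I.
move=> mk; apply: (measurableT_comp (f := fine)) => //.
by apply: (measurableT_comp mk); exact: pair1_measurable.
Qed.

Lemma resp_at01 t (h : t.-tuple (round R U X)) s : 0 <= resp_at h s <= 1.
Proof.
by have [] := @prob_kernel_bool_ge R _ _ (qr t) (h, s) (fun=> 0%E) (fun=> 0) (fun=> lexx _) (fun=> lexx _).
Qed.

Lemma resp01 t (h : t.-tuple (round R U X)) M W : 0 <= resp h M W <= 1.
Proof.
have mf := measurableT_comp (measurable_resp_at h) (mS (W :|: M)).
exact: (@probability_Rintegral01 R _ _ (Aux M (W :\: M)) _ mf (fun x => resp_at01 h _)).2.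
Qed.

(** The responder's bit is a function of the sketch with values in [0, 1], so total variation bounds
    the change of its mean when D' replaces D. The shadow [p'] is chosen before [q]: the same
    function serves all rates, which makes its mean a polynomial in [q]. *)
Lemma resp_shadowed delta L : determining_pool S Aux rt delta L ->
  forall t (h : t.-tuple (round R U X)), exists p' : {set U} -> {set U} -> R,
  forall (M : {set U}) (q : R), M \subset L -> qmin rt <= q <= qmax rt -> shadowed L M (resp h M) (p' M) delta q.
Proof.
move=> [D' hD] t h.
exists (fun M V => \int[D' M V]_s resp_at h s) => M q ML hq.
have q01 : 0 <= q <= 1.
  by case: ok => *; move/andP: hq => [? ?]; apply/andP; split; lra.
split => //.
- by move=> W; exact: resp01.
- by move=> W; exact: (probability_Rintegral01 _ (measurable_resp_at h) (resp_at01 h)).2.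
- apply: le_trans (hD M q ML hq); apply: ler_sum => W _; apply: ler_wpM2l.
    exact: bern_ge0.
  have E : (W :\: M) :|: M = W :|: M.
    by apply/setP => x; rewrite !inE; case: (x \in M); rewrite ?orbT ?orbF.
  rewrite /sketch_law E.
  exact: Rintegral_tv_dist (mS _) (measurable_resp_at h) (resp_at01 h).
Qed.

Lemma transcript_prob_ge0 r E k t (h : t.-tuple (round R U X)) :
  (0 <= transcript_prob S Aux rt qr r E k h)%E.
Proof.
elim: k t h => [|k IH] t h /=; first by rewrite lee_fin.
(* For [q] outside [0, 1] the product [bern q W] may be negative, but there the density vanishes. *)
apply: integral_ge0 => q _; have [hq|hq] := boolP (qmin rt <= q <= qmax rt); last first.
  by rewrite /rate_density rate_weight_eq0 // mul0r mul0e.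
have q01 : 0 <= q <= 1.
  by case: ok => *; move/andP: hq => [? ?]; apply/andP; split; lra.
apply: mule_ge0.
  by rewrite lee_fin divr_ge0 ?(rate_weight_ge0 ok) // ltW // (rate_mass_gt0 ok).
apply: sume_ge0 => W _; apply: mule_ge0; first by rewrite lee_fin bern_ge0.
by apply: integral_ge0 => x _; apply: integral_ge0 => z _; exact: IH.
Qed.

(** One step of the backward induction. The bound [G] on the later failure probability ignores the
    auxiliary [x], so integrating over [x] and the bit leaves only the averaged response law
    [resp h M]. *)
Lemma transcript_prob_ge r E k t (h : t.-tuple (round R U X))
    (G : R -> {set U} -> bool -> R) (c : R) :
  let M := Defs.mask (attacker_after r h) in
  (forall W z, continuous (fun q => G q W z)) ->
  (forall q W x z, qmin rt <= q <= qmax rt ->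
    ((1 - G q W z)%:E <= transcript_prob S Aux rt qr r E k (rcons_tuple h (q, W, x, z)))%E) ->
  rate_int rt (fun q => mean (resp h M) (G q) q) <= c * rate_mass rt ->
  ((1 - c)%:E <= transcript_prob S Aux rt qr r E k.+1 h)%E.
Proof.
move=> M cG hG hc /=; rewrite -/M.
have q01 q : qmin rt <= q <= qmax rt -> 0 <= q <= 1.
  by move=> /andP[? ?]; case: ok => *; apply/andP; split; lra.
apply: (rate_expect_ge ok (phi := fun q => mean (resp h M) (G q) q)) => //.
- move=> q hq; apply: sume_ge0 => W _; apply: mule_ge0; first by rewrite lee_fin bern_ge0 ?q01.
  by apply: integral_ge0 => x _; apply: integral_ge0 => z _; exact: transcript_prob_ge0.
- exact: continuous_mean.
move=> q hq; pose psi W z := Num.max 0 (1 - G q W z).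
have psi0 W z : 0 <= psi W z by rewrite le_max lexx.
have E1 : 1 - mean (resp h M) (G q) q =
    \sum_(W : {set U}) bern q W * (resp h M W * (1 - G q W true) + (1 - resp h M W) * (1 - G q W false)).
  rewrite -[in LHS](sum_bern U q) /mean -sumrB; apply: eq_bigr => W _; ring.
rewrite E1 -sumEFin; apply: lee_sum => W _; rewrite EFinM.
apply: lee_wpmul2l; first by rewrite lee_fin bern_ge0 ?q01.
have mf := measurableT_comp (measurable_resp_at h) (mS (W :|: M)).
have f01 x := resp_at01 h (S (W :|: M) x).
have [intf /andP[r0 r1]] := @probability_Rintegral01 R _ _ (Aux M (W :\: M)) _ mf f01.
apply: (@le_trans _ _ (\int[Aux M (W :\: M)]_x
  (resp_at h (S (W :|: M) x) * psi W true + (1 - resp_at h (S (W :|: M) x)) * psi W false)%:E)%E); last first.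
  apply: ge0_le_lower_integral => x.
    have /andP[h0 h1] := f01 x.
    by rewrite lee_fin addr_ge0 // mulr_ge0 // subr_ge0.
  apply: (@prob_kernel_bool_ge R _ _ (qr t) (h, S (W :|: M) x) _ (psi W) (psi0 W) _).2 => z.
  by rewrite /psi EFin_max ge_max transcript_prob_ge0 hG.
have -> : (\int[Aux M (W :\: M)]_x
  (resp_at h (S (W :|: M) x) * psi W true + (1 - resp_at h (S (W :|: M) x)) * psi W false)%:E)%E =
  (resp h M W * psi W true + (1 - resp h M W) * psi W false)%:E.
  have intc : (Aux M (W :\: M)).-integrable setT (EFin \o cst (psi W false)).
    exact: finite_measure_integrable_cst.
  have intz := integrableZl measurableT (psi W true - psi W false) intf.
  have -> : (resp h M W * psi W true + (1 - resp h M W) * psi W false) =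
    \int[Aux M (W :\: M)]_x (psi W false + (psi W true - psi W false) * resp_at h (S (W :|: M) x)).
    rewrite RintegralD // RintegralZl // Rintegral_cst // (_ : fine _ = 1) ?mulr1.
      by rewrite /resp; ring.
    exact: congr1 (probability_setT (Aux M (W :\: M))).
  rewrite /Rintegral fineK.
    by apply: eq_integral => x _; congr (_%:E); ring.
  apply: integrable_fin_num => //.
  exact: (integrableD measurableT intc intz).
rewrite lee_fin; apply: lerD; apply: ler_wpM2l => //; rewrite ?subr_ge0 // /psi le_max lexx orbT //.
Qed.

End Transcript.

(** * The potential *)

Section Mean.
Variables (R : realType) (U : finType) (p : {set U} -> R).

Lemma mean_lin (F G : {set U} -> bool -> R) (C K : R) q :
  mean p (fun W z => F W z * C + K * G W z) q = mean p F q * C + K * mean p G q.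
Proof.
rewrite /mean mulr_suml mulr_sumr -big_split /=.
by apply: eq_bigr => W _; ring.
Qed.

Lemma mean_sum (I : finType) (P : pred I) (F : I -> {set U} -> bool -> R) q :
  mean p (fun W z => \sum_(i | P i) F i W z) q = \sum_(i | P i) mean p (F i) q.
Proof.
rewrite /mean exchange_big /=; apply: eq_bigr => W _.
by rewrite !mulr_sumr -big_split /= mulr_sumr.
Qed.

End Mean.

Section Ledger.
Variables (R : realType) (U : finType) (dX : measure_display) (X : measurableType dX)
  (r : nat) (A B : R).

Definition ledger_after (h : seq (round R U X)) : ledger R U :=
  foldl (fun a e => let: (q, W, _, z) := e in ledger_step r A B a q W z) (ledger0 R U) h.

Lemma atk_ledger_after h : atk (ledger_after h) = attacker_after r h.
Proof.
rewrite /ledger_after /attacker_after.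
have -> : attacker0 U = atk (ledger0 R U) by [].
elim: h (ledger0 R U) => //= -[[[q W] x] z] h IH a.
by rewrite IH.
Qed.

Lemma errs_ledger_after h : errs (ledger_after h) = errors A B r h.
Proof.
rewrite /ledger_after /errors -[RHS]add0n.
have -> : attacker0 U = atk (ledger0 R U) by [].
rewrite -[0%N]/(errs (ledger0 R U)).
elim: h (ledger0 R U) => [|[[[q W] x] z] h IH] a /=; first by rewrite addn0.
by rewrite IH /= addnA.
Qed.

Lemma ledger_after_rcons h q W x z :
  ledger_after (rcons h (q, W, x, z)) = ledger_step r A B (ledger_after h) q W z.
Proof. by rewrite /ledger_after -cats1 foldl_cat. Qed.

Lemma sum_adv_step (L : {set U}) (a : ledger R U) q W z :
  \sum_(x in L) adv (ledger_step r A B a q W z) x =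
  \sum_(x in L) adv a x + z%:R * devs (L :\: Defs.mask (atk a)) q W.
Proof.
rewrite /= big_split /=; congr (_ + _); rewrite /devs mulr_sumr.
rewrite big_mkcond [RHS]big_mkcond /=; apply: eq_bigr => x _.
by rewrite inE; case: (x \in L); case: (x \in Defs.mask _).
Qed.

End Ledger.

Section Potential.
Variables (R : realType) (U : finType) (dX : measure_display) (X : measurableType dX)
  (dS : measure_display) (Sg : measurableType dS) (S : {set U} -> X -> Sg)
  (Aux : {set U} -> {set U} -> probability X R) (rt : rates R) (delta : R)
  (L : {set U}) (qr : responder R U X Sg) (r : nat) (A B : R).
Variables (D lam kap m sig H0 d : R) (E : seq (round R U X) -> bool).
Let thr : R := 16 * Num.sqrt (r%:R * ln (r%:R * #|U|%:R)).
Let tau : R := lam * d + 2 * lam ^+ 2.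

Hypothesis mS : forall V : {set U}, measurable_fun setT (S V).
Hypothesis ok : rates_ok rt.
Hypothesis pool : determining_pool S Aux rt delta L.
Hypothesis dd : delta <= d.
Hypothesis Lhalf : (2 * #|L| < #|U|)%N.
Hypothesis Dthr : 2 * D + 1 < thr.
Hypothesis lam0 : 0 <= lam.
Hypothesis lam1 : lam <= 1 / 2.
Hypothesis d0 : 0 <= d.
Hypothesis m0 : 0 <= m.
Hypothesis round_gain : forall (M : {set U}) (p : {set U} -> R) (p' : {set U} -> {set U} -> R),
  M \subset L -> (forall q, qmin rt <= q <= qmax rt -> shadowed L M p (p' M) d q) ->
  rate_int rt (fun q => mean p (fun W z => expR (- m * gain L M A B kap q W z)) q) <=
  expR sig * rate_mass rt.
Hypothesis final : forall h : seq (round R U X),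
  ledger_inv L (D + 1 + thr) (ledger_after r A B h) ->
  H0 < (errs (ledger_after r A B h))%:R + kap * \sum_(x in L) adv (ledger_after r A B h) x ->
  E h.

(* Exponential supermartingales, k rounds before the end: pot_out controls the scores outside L,
   and pot_total the number of errors plus kap times the sum of the scores in L. *)
Definition pot_out (k : nat) (a : ledger R U) : R :=
  (\sum_(x | x \notin L) (expR (lam * adv a x) + expR (- lam * adv a x))) *
  expR (- lam * D + k%:R * tau).

Definition pot_total (k : nat) (a : ledger R U) : R :=
  expR (- m * ((errs a)%:R + kap * \sum_(x in L) adv a x - H0) + k%:R * sig).

Definition pot (k : nat) (a : ledger R U) : R := pot_out k a + pot_total k a.

Lemma pot_out_ge0 k a : 0 <= pot_out k a.
Proof.
by rewrite mulr_ge0 ?expR_ge0 //; apply: sumr_ge0 => x _; rewrite addr_ge0 ?expR_ge0.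
Qed.

(** If [adv a x] exceeded [D] in absolute value, one of its two exponentials times
    [expR (- lam * D)] would already be at least 1. So smallness of the potential gives a bound
    without any exceptional event. *)
Lemma pot_lt1_adv k a x : pot k a < 1 -> x \notin L -> `|adv a x| <= D.
Proof.
move=> a1 xL; rewrite leNgt; apply/negP => hD; move: a1; rewrite ltNge => /negP; apply.
have l0 := lam0; have d0' := d0.
have t0 : 0 <= k%:R * tau by rewrite mulr_ge0 // addr_ge0 ?mulr_ge0 ?sqr_ge0.
rewrite /pot; apply: (@le_trans _ _ (pot_out k a)); last by rewrite lerDl expR_ge0.
rewrite /pot_out (bigD1 x) //= mulrDl; apply: (@le_trans _ _ ((expR (lam * adv a x) + expR (- lam * adv a x)) * expR (- lam * D + k%:R * tau))); last first.
  by rewrite lerDl mulr_ge0 ?expR_ge0 //; apply: sumr_ge0 => y _; rewrite addr_ge0 ?expR_ge0.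
rewrite mulrDl -!expRD.
have e y : 0 <= y -> 1 <= expR y by move=> y0; rewrite -expR0 ler_expR.
have [s|s] := leP 0 (adv a x).
  rewrite ger0_norm // in hD; apply: (@le_trans _ _ (expR (lam * adv a x + (- lam * D + k%:R * tau)))); last by rewrite lerDl expR_ge0.
  apply: e; have : 0 <= lam * (adv a x - D) by rewrite mulr_ge0 // subr_ge0 ltW.
  by lra.
rewrite ltr0_norm // in hD; apply: (@le_trans _ _ (expR (- lam * adv a x + (- lam * D + k%:R * tau)))); last by rewrite lerDr expR_ge0.
apply: e; have : 0 <= lam * (- adv a x - D) by rewrite mulr_ge0 // subr_ge0 ltW.
by lra.
Qed.

Lemma continuous_pot_step k a W z : continuous (fun q => pot k (ledger_step r A B a q W z)).
Proof.
have cadv x : continuous (fun q => adv (ledger_step r A B a q W z) x).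
  move=> q /=; apply: cvgD; first exact: cvg_cst.
  case: (x \in _); first exact: cvg_cst.
  by apply: cvgMr; exact: continuous_dev.
have csum : continuous (fun q => \sum_(x in L) adv (ledger_step r A B a q W z) x).
  exact: continuous_fsum.
have cout : continuous (fun q => \sum_(x | x \notin L) (expR (lam * adv (ledger_step r A B a q W z) x) + expR (- lam * adv (ledger_step r A B a q W z) x))).
  apply: continuous_fsum => x q.
  have c1 := @continuous_expRM R lam (fun q => adv (ledger_step r A B a q W z) x) (cadv x).
  have c2 := @continuous_expRM R (- lam) (fun q => adv (ledger_step r A B a q W z) x) (cadv x).
  by apply: cvgD; [exact: c1|exact: c2].
have cl : continuous (fun q => - m * ((errs (ledger_step r A B a q W z))%:R +
     kap * \sum_(x in L) adv (ledger_step r A B a q W z) x - H0) + k%:R * sig).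
  move=> q'; apply: cvgD; last exact: cvg_cst.
  apply: cvgMr; apply: cvgB; last exact: cvg_cst.
  apply: cvgD; first exact: cvg_cst.
  by apply: cvgMr; exact: csum.
have ct : continuous (fun q => pot_total k (ledger_step r A B a q W z)).
  move=> q; apply: (@continuous_comp _ _ _ (fun q => - m * ((errs (ledger_step r A B a q W z))%:R +
     kap * \sum_(x in L) adv (ledger_step r A B a q W z) x - H0) + k%:R * sig) expR).
    exact: cl.
  exact: continuous_expR.
move=> q; apply: cvgD; last exact: ct.
by apply: cvgMl; exact: cout.
Qed.

(** The supermartingale property. The two halves lose at most the factors [expR tau] and [expR sig],
    which are the factors carried for each remaining round; [sig] bounds only the average over the
    rate, so the total potential is treated after integration. *)
Lemma pot_step k (a : ledger R U) (p : {set U} -> R) (p' : {set U} -> {set U} -> R) :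
  let M := Defs.mask (atk a) in M \subset L ->
  (forall q, qmin rt <= q <= qmax rt -> shadowed L M p (p' M) d q) ->
  rate_int rt (fun q => mean p (fun W z => pot k (ledger_step r A B a q W z)) q) <=
  pot k.+1 a * rate_mass rt.
Proof.
move=> M ML sh; pose K := pot_total k a.
have q01 q : qmin rt <= q <= qmax rt -> 0 <= q <= 1 by move=> /sh [].
have lam_abs : `|lam| = lam by rewrite ger0_norm ?lam0.
have E1 q W z : pot k (ledger_step r A B a q W z) =
   (\sum_(x | x \notin L) (expR (lam * adv a x) * expR (lam * (z%:R * dev q x W)) +
     expR (- lam * adv a x) * expR (- lam * (z%:R * dev q x W)))) *
    expR (- lam * D + k%:R * tau) + K * expR (- m * gain L M A B kap q W z).
  rewrite /pot /pot_out /pot_total; congr (_ * _ + _).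
    apply: eq_bigr => x xL.
    have xM : x \notin M by apply: contra xL; apply: (fintype.subsetP ML).
    by rewrite /= (negbTE xM) -!expRD -!mulrDr.
  rewrite /K /pot_total -expRD sum_adv_step /= natrD /gain -/M; congr expR; ring.
pose c := fun q => mean p (fun W z => expR (- m * gain L M A B kap q W z)) q.
have cc : continuous c.
  apply: continuous_mean => W z; apply: (@continuous_expRM R (- m) (fun q => gain L M A B kap q W z)) => q.
  apply: cvgD; first exact: cvg_cst.
  by apply: cvgMr; apply: cvgMr; exact: continuous_devs.
have le1 : rate_int rt (fun q => mean p (fun W z => pot k (ledger_step r A B a q W z)) q) <=
    rate_int rt (fun q => pot_out k.+1 a + K * c q).
  apply: (le_rate_int ok).
  - by apply: continuous_mean => W z; exact: continuous_pot_step.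
  - by move=> q; apply: cvgD; [exact: cvg_cst|apply: cvgMr; exact: cc].
  move=> q hq; have shq := sh q hq; have [_ p01 _ _] := shq.
  have -> : mean p (fun W z => pot k (ledger_step r A B a q W z)) q =
    (\sum_(x | x \notin L) mean p (fun W z => (expR (lam * adv a x) * expR (lam * (z%:R * dev q x W)) +
     expR (- lam * adv a x) * expR (- lam * (z%:R * dev q x W)))) q) *
      expR (- lam * D + k%:R * tau) + K * c q.
    rewrite -mean_sum -mean_lin; apply: eq_bigr => W _; by rewrite !E1.
  rewrite lerD2r /pot_out.
  have -> : - lam * D + k.+1%:R * tau = tau + (- lam * D + k%:R * tau).
    by rewrite -natr1; ring.
  rewrite expRD mulrA; apply: ler_wpM2r; first exact: expR_ge0.
  rewrite mulr_suml; apply: ler_sum => x xL.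
  have E2 : mean p (fun W z => (expR (lam * adv a x) * expR (lam * (z%:R * dev q x W)) +
     expR (- lam * adv a x) * expR (- lam * (z%:R * dev q x W)))) q =
     mean p (fun W z => expR (lam * (z%:R * dev q x W))) q * expR (lam * adv a x) +
     expR (- lam * adv a x) * mean p (fun W z => expR (- lam * (z%:R * dev q x W))) q.
    by rewrite -mean_lin; apply: eq_bigr => W _; rewrite ![expR (lam * adv a x) * _]mulrC.
  rewrite E2 mulrDl; apply: lerD.
    rewrite mulrC; apply: ler_wpM2l; first exact: expR_ge0.
    apply: le_trans (mean_exp_outside shq xL _) _; first by rewrite lam_abs lam1.
    by rewrite lam_abs.
  apply: ler_wpM2l; first exact: expR_ge0.
  apply: le_trans (mean_exp_outside shq xL _) _; first by rewrite normrN lam_abs lam1.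
  by rewrite normrN lam_abs sqrrN.
apply: (le_trans le1); rewrite (rate_int_affine ok) // /pot mulrDl lerD2l.
have -> : pot_total k.+1 a = K * expR sig.
  by rewrite /K /pot_total -expRD -natr1; congr expR; ring.
rewrite -mulrA; apply: ler_wpM2l; first exact: expR_ge0.
exact: (round_gain (p' := p')).
Qed.

(** If the potential is at least 1, the claim follows from nonnegativity. Otherwise the scores
    outside L are bounded, the invariant survives any next round, and induction applies. At the end,
    a potential below 1 forces the tracked number above [H0]. *)
Lemma transcript_prob_pot k t (h : t.-tuple (round R U X)) :
  ledger_inv L (D + 1 + thr) (ledger_after r A B h) ->
  ((1 - pot k (ledger_after r A B h))%:E <= transcript_prob S Aux rt qr r E k h)%E.
Proof.
have triv j i (h' : i.-tuple (round R U X)) : 1 <= pot j (ledger_after r A B h') ->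
    ((1 - pot j (ledger_after r A B h'))%:E <= transcript_prob S Aux rt qr r E j h')%E.
  move=> p1; apply: (@le_trans _ _ 0%E); first by rewrite lee_fin subr_le0.
  exact: transcript_prob_ge0.
elim: k t h => [|k IH] t h inv.
  have [/triv//|p1] := leP 1 (pot 0 (ledger_after r A B h)).
  rewrite /= (final inv); first by rewrite lee_fin lerBlDr lerDl addr_ge0 ?pot_out_ge0 ?expR_ge0.
  rewrite ltNge; apply/negP => h1; move: p1; rewrite ltNge => /negP; apply.
  apply: (@le_trans _ _ (pot_total 0 (ledger_after r A B h))); last by rewrite lerDr pot_out_ge0.
  rewrite /pot_total mul0r addr0 -[leLHS]expR0 ler_expR mulNr -mulrN mulr_ge0 ?m0 //.
  by rewrite oppr_ge0 subr_le0.
have [/triv//|p1] := leP 1 (pot k.+1 (ledger_after r A B h)).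
have hadv x : x \notin L -> `|adv (ledger_after r A B h) x| <= D.
  by move=> xL; exact: (pot_lt1_adv p1 xL).
have [p' hp'] := resp_shadowed qr mS ok pool h.
have ML : Defs.mask (attacker_after r h) \subset L.
  by rewrite -(atk_ledger_after r A B); case: inv.
have sh q : qmin rt <= q <= qmax rt ->
  shadowed L (Defs.mask (attacker_after r h)) (resp S Aux qr h (Defs.mask (attacker_after r h))) (p' (Defs.mask (attacker_after r h))) d q.
  move=> hq; have [s1 s2 s3 s4] := hp' _ q ML hq; split => //.
  exact: le_trans s4 dd.
apply: (transcript_prob_ge mS ok (G := fun q W z => pot k (ledger_step r A B (ledger_after r A B h) q W z))).
- by move=> W z; exact: continuous_pot_step.
- move=> q W x z hq; rewrite -(ledger_after_rcons r A B h q W x z).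
  apply: (IH t.+1 (rcons_tuple h (q, W, x, z))) => /=.
  rewrite ledger_after_rcons; apply: ledger_inv_step => //.
  by case: (sh q hq).
- by rewrite -(atk_ledger_after r A B); apply: (@pot_step k (ledger_after r A B h) _ p'); rewrite atk_ledger_after.
Qed.

End Potential.

(** * The exponential moment of one round, averaged over the rate *)

Section RoundGain.
Variables (R : realType) (U : finType) (L : {set U}) (rt : rates R) (a b g : R).
Hypothesis ok : rates_ok rt.
Local Notation n := (#|U|%:R : R).
Local Notation l := (#|L|%:R : R).
Local Notation w1 := (q1 rt - qmin rt).
Local Notation w2 := (qmax rt - q2 rt).
Local Notation Mx := (qmax rt * (1 - qmin rt)).
Let th := w1 * w2 / (w1 + w2).
Let kap := th / Mx.

(** The gap [g] between the ramps and the thresholds becomes a deviation of [g n] in Chebyshev's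
    inequality. [T] bounds the gain, so tilting by [m] costs the second-order term [2 (m T)^2]. *)
Lemma mean_exp_gain_rate (M : {set U}) (p p' : {set U} -> R) (d eps m T : R) :
  0 < g -> 0 < n -> q1 rt + g <= a - l / n -> b + g <= q2 rt ->
  kap * (l * d) + d + n / (g * n) ^+ 2 <= eps -> 0 <= d ->
  1 + kap * l <= T -> 0 <= m -> m * T <= 1 / 2 -> M \subset L ->
  (forall q, qmin rt <= q <= qmax rt -> shadowed L M p p' d q) ->
  rate_int rt (fun q => mean p (fun W z => expR (- m * gain L M (a * n) (b * n) kap q W z)) q) <=
  expR (2 * (m * T) ^+ 2 - m * (th / (2 * Mx * rate_mass rt) - eps)) * rate_mass rt.
Proof.
move=> g0 n0 gA gB small d0 kT m0 mT ML sh.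
have N0 := rate_mass_gt0 ok.
have [lo0 lol1 l12 l2hi hi1] := ok.
have Mx0 : 0 < Mx by rewrite mulr_gt0 //; lra.
have th0 : 0 < th by rewrite /th; apply: divr_gt0; [apply: mulr_gt0; lra|lra].
have kap0 : 0 <= kap by rewrite /kap divr_ge0 // ltW.
pose pL W := p' (W :&: (L :\: M)).
pose G q := mean p (gain L M (a * n) (b * n) kap q) q.
have cg W z : continuous (fun q => gain L M (a * n) (b * n) kap q W z).
  move=> q; apply: cvgD; first exact: cvg_cst.
  by apply: cvgMr; apply: cvgMr; exact: continuous_devs.
have cG : continuous G by apply: continuous_mean.
have gn0 : 0 < g * n by rewrite mulr_gt0.
have lM : #|M|%:R <= l by rewrite ler_nat subset_leq_card.
have l0 : 0 <= l by rewrite ler0n.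
have ln : l / n * n = l by rewrite mulfVK // gt_eqF.
have k0d : 0 <= kap * (l * d) by apply: mulr_ge0 => //; exact: mulr_ge0.
have ss0 : 0 <= n / (g * n) ^+ 2 by rewrite divr_ge0 // ?sqr_ge0 // ltW.
have gainG := @rate_gain R rt ok (bern_poly pL) G eps cG.
have {}gainG : th / (2 * Mx) - eps * rate_mass rt <= rate_int rt G.
  apply: gainG.
  - by move=> q hq; have := shadow_poly (sh q hq).
  - move=> q hq; apply: le_trans (mean_gain_mid _ _ (sh q hq) kap0); rewrite -/th -/kap; lra.
  - move=> q hq; have hq' : qmin rt <= q <= qmax rt by apply/andP; split; lra.
    apply: le_trans (mean_gain_low (s := g * n) _ (sh q hq') kap0 gn0 _).
      by rewrite -/th -/kap; lra.
    (* The mask adds at most [#|L|] elements to the query; this is why q1 has to stay below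
       [a - l / n] and not only below [a]. *)
    move=> W hW; rewrite devsT; apply: le_trans (ler_norm _).
    have : #|W :|: M|%:R <= #|W|%:R + #|M|%:R :> R.
      by rewrite -natrD ler_nat cardsU leq_subr.
    have : (q - (a - l / n - g)) * n <= 0 by rewrite pmulr_lle0 //; lra.
    rewrite !mulrBl ln (mulrC q); lra.
  - move=> q hq; have hq' : qmin rt <= q <= qmax rt by apply/andP; split; lra.
    apply: le_trans (mean_gain_high (s := g * n) _ (sh q hq') kap0 gn0 _).
      by rewrite -/th -/kap; lra.
    move=> W hW; rewrite devsT -normrN; apply: le_trans (ler_norm _).
    have : #|W|%:R <= #|W :|: M|%:R :> R.
      by rewrite ler_nat subset_leq_card // finset.subsetUl.
    have : 0 <= (q - (b + g)) * n by rewrite pmulr_lge0 //; lra.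
    rewrite mulrBl mulrDl (mulrC q); lra.
apply: (@le_trans _ _ (rate_int rt (fun q => 1 + 2 * (m * T) ^+ 2 + - m * G q))).
  apply: (le_rate_int ok).
  - apply: continuous_mean => W z; apply: (@continuous_expRM R (- m) (fun q => gain L M (a * n) (b * n) kap q W z)).
    exact: cg.
  - by move=> q; apply: cvgD; [exact: cvg_cst|apply: cvgMr; exact: cG].
  - by move=> q hq; rewrite mulNr; apply: (mean_exp_gain _ _ (sh q hq)).
rewrite (rate_int_affine ok) //; apply: (@le_trans _ _
  ((1 + (2 * (m * T) ^+ 2 - m * (th / (2 * Mx * rate_mass rt) - eps))) * rate_mass rt)).
  have -> : (1 + (2 * (m * T) ^+ 2 - m * (th / (2 * Mx * rate_mass rt) - eps))) * rate_mass rt =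
    (1 + 2 * (m * T) ^+ 2) * rate_mass rt - m * (th / (2 * Mx) - eps * rate_mass rt).
    by field; rewrite ?gt_eqF //; lra.
  by rewrite mulNr lerD2l lerN2 ler_wpM2l.
by rewrite ler_wpM2r ?expR_ge1Dx // ltW.
Qed.

End RoundGain.

(** * Size of the number of rounds *)

Section Rounds.
Variable R : realType.

(** The number of rounds is polynomial in [n]: from [r <= 2 K n^3] and [2 K <= n] follows
    [r n <= n^5], so the attacker's [ln (r n)] is comparable to [ln n]. *)
Lemma rounds_bounds (K n l : R) : 20 <= K -> expR 1 <= n -> 2 * K <= n -> 1 <= l -> l <= n ->
  let r := `|Num.ceil (K * l ^+ 2 * ln n)|%N in
  let La := ln (r%:R * n) in
  [/\ K * l ^+ 2 * ln n <= r%:R, r%:R <= 2 * K * n ^+ 3,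
      1 <= ln n, ln n <= La & La <= 5 * ln n].
Proof.
move=> K20 en Kn l1 ln_ r La.
have n1 : 1 <= n by apply: le_trans en; rewrite -expR0 ler_expR.
have n0 : 0 < n by lra.
have lnn : 1 <= ln n by rewrite -(expRK 1) ler_ln ?posrE ?expR_gt0.
set x := K * l ^+ 2 * ln n.
have l2 : 1 <= l ^+ 2 by rewrite exprn_ege1.
have x1 : 1 <= x.
  have : 1 <= K * l ^+ 2 by nra.
  by rewrite /x => h; nra.
have rE : r%:R = (Num.ceil x)%:~R :> R.
  by rewrite /r natr_absz ger0_norm // -(ler0z R); apply: (@le_trans _ _ x); [lra|exact: ceil_ge].
have xr : x <= r%:R by rewrite rE ceil_ge.
have rx : r%:R < x + 1 by have /andP[h _] := ceil_itv x; rewrite rE; move: h; rewrite intrB; lra.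
have ln_n : ln n <= n by rewrite ltW // ln_sublinear.
have x3 : x <= K * n ^+ 3.
  have l2n : l ^+ 2 <= n ^+ 2 by rewrite lerXn2r ?nnegrE //; lra.
  rewrite /x (exprSr n) mulrA; apply: ler_pM => //; try lra.
    by rewrite mulr_ge0 ?sqr_ge0 //; lra.
  by rewrite ler_wpM2l //; lra.
have n3 : 1 <= n ^+ 3 by rewrite exprn_ege1.
have r3 : r%:R <= 2 * K * n ^+ 3 by nra.
have r1 : 1 <= r%:R :> R by lra.
have rn0 : 0 < r%:R * n by rewrite mulr_gt0 //; lra.
split => //.
  rewrite /La ler_ln ?posrE //.
  by rewrite -[leLHS]mul1r ler_pM2r.
have -> : 5 * ln n = ln (n ^+ 5) by rewrite lnXn // mulr_natl.
rewrite /La ler_ln ?posrE ?exprn_gt0 // [n ^+ 5]exprSr ler_pM2r //.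
apply: (le_trans r3); rewrite [n ^+ 4]exprS ler_pM2r //; lra.
Qed.

End Rounds.

(** * The error rate *)

Section ErrorRate.
Variable R : realType.

(* The factor 1 - (qmax - qmin) leaves room for the deviations. The rest is the least mean error
   of a responder whose bits carry no information on L, where the density 1/(q(1 - q)) is replaced
   by its extreme values on [qmin, qmax]. *)
Definition error_rate (rt : rates R) : R :=
  let w1 := q1 rt - qmin rt in
  let w2 := qmax rt - q2 rt in
  (1 - (qmax rt - qmin rt)) *
  (qmin rt * (1 - qmax rt) / (qmax rt * (1 - qmin rt))) *
  (w1 * w2 / (w1 + w2)) / (w1 + 2 * (q2 rt - q1 rt) + w2).

Lemma prod3_near1 (x y z eps : R) : 0 < eps -> 0 <= x -> 0 <= y -> 0 <= z ->
  x <= 1 -> y <= 1 -> z <= 1 -> x <= eps / 2 -> y <= eps / 2 -> z <= eps ->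
  `|(1 - x) * (1 - y) * (1 - z) / 4 - 4^-1| < eps.
Proof.
move=> e0 x0 y0 z0 x1 y1 z1 xe ye ze.
have P1 : 0 <= (1 - x) * (1 - y) by rewrite mulr_ge0 // subr_ge0.
have P2 : (1 - x) * (1 - y) <= 1 by rewrite mulr_ile1 ?subr_ge0 // gerBl.
have P3 : 1 - x - y <= (1 - x) * (1 - y).
  have : 0 <= x * y by rewrite mulr_ge0.
  lra.
move: P1 P2 P3; set u := (1 - x) * (1 - y) => P1 P2 P3.
have Q1 : u * (1 - z) <= 1 by rewrite mulr_ile1 ?subr_ge0 // gerBl.
have Q2 : u - z <= u * (1 - z).
  have : 0 <= (1 - u) * z by rewrite mulr_ge0 // subr_ge0.
  lra.
by rewrite ltr_norml; apply/andP; split; lra.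
Qed.

(** Both ramps get the same width [w] and the plateau has length [d]. The rate then factors as 1/4
    times [1 - (hi - lo)], the variance ratio [1 - (hi - lo) / Mx], and [1 - d / (w + d)]. So [w]
    has to be small, and [d] small compared with [w]. *)
Lemma error_rate_limit (k eps : R) : 0 < k -> 0 < eps ->
  exists th g : R, [/\ 0 < th & 0 < g] /\
    forall a b lam : R, k <= a -> a < b -> b <= 1 - k ->
      b / a <= 1 + th -> 0 <= lam -> lam <= th ->
      exists rt : rates R, rates_gap a b lam g rt /\ `|error_rate rt - 4^-1| < eps.
Proof.
(* [w <= k / 4] keeps the rates inside (0, 1), and [w <= k^2 eps / 6] makes [hi - lo <= 3 w] at most
   [k^2 eps / 2]. With [g = w s / 4], the plateau is at most [4 g = w s] long. *)
move=> k0 e0; pose s := Num.min 1 eps; pose w := Num.min (k / 4) (k ^+ 2 * eps / 6).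
have s0 : 0 < s by rewrite lt_min ltr01.
have s1 : s <= 1 by rewrite ge_min lexx.
have se : s <= eps by rewrite ge_min lexx orbT.
have w0 : 0 < w by rewrite lt_min !divr_gt0 // mulr_gt0 // exprn_gt0.
have wk : w <= k / 4 by rewrite ge_min lexx.
have we : w <= k ^+ 2 * eps / 6 by rewrite ge_min lexx orbT.
pose g := w * s / 4.
have g0 : 0 < g by rewrite divr_gt0 // mulr_gt0.
have gw : g <= w / 4 by rewrite /g ler_pM2r // ler_piMr // ltW.
exists g, g; split => // a b lam ka ab bk ba lam0 lamg.
have a0 : 0 < a by lra.
have {}ba : b - a <= g.
  move: ba; rewrite ler_pdivrMr // => ba.
  have : g * a <= g * 1 by rewrite ler_wpM2l //; lra.
  lra.
exists (Rates (a - lam - g - w) (a - lam - g) (b + g) (b + g + w)).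
split; first by split; split => /=; lra.
rewrite /error_rate /=.
set lo := a - lam - g - w; set hi := b + g + w; pose d := b + g - (a - lam - g).
have d0 : 0 < d by rewrite /d; lra.
have dw : d <= w * s.
  have : g * 4 = w * s by rewrite /g; field.
  by rewrite /d; lra.
have X : hi - lo = 2 * w + d by rewrite /hi /lo /d; ring.
have lo0 : 0 < lo by rewrite /lo; lra.
have hi1 : hi < 1 by rewrite /hi; lra.
have kh : k <= hi by rewrite /hi; lra.
have kl : k <= 1 - lo by rewrite /lo; lra.
pose Mx := hi * (1 - lo).
have Mk : k ^+ 2 <= Mx by rewrite expr2 /Mx ler_pM // ltW.
have k20 : 0 < k ^+ 2 by rewrite exprn_gt0.
have Mx0 : 0 < Mx by lra.
have -> : (1 - (hi - lo)) * (lo * (1 - hi) / (hi * (1 - lo))) *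
    ((a - lam - g - lo) * (hi - (b + g)) / (a - lam - g - lo + (hi - (b + g)))) /
    (a - lam - g - lo + 2 * (b + g - (a - lam - g)) + (hi - (b + g))) =
   (1 - (hi - lo)) * (1 - (hi - lo) / Mx) * (1 - d / (w + d)) / 4.
  have -> : a - lam - g - lo = w by rewrite /lo; ring.
  have -> : hi - (b + g) = w by rewrite /hi; ring.
  rewrite -/d; have -> : lo * (1 - hi) / (hi * (1 - lo)) = 1 - (hi - lo) / Mx.
    rewrite /Mx; field; rewrite ?gt_eqF //; lra.
  by field; rewrite ?gt_eqF //; lra.
have X0 : 0 <= hi - lo by lra.
have X3 : hi - lo <= 3 * w.
  have : w * s <= w * 1 by rewrite ler_wpM2l // ltW.
  lra.
have Y0 : 0 <= (hi - lo) / Mx by rewrite divr_ge0 // ltW.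
have Y1 : (hi - lo) / Mx <= eps / 2.
  rewrite ler_pdivrMr //; apply: (@le_trans _ _ (eps / 2 * k ^+ 2)); first lra.
  by rewrite ler_wpM2l // divr_ge0 // ltW.
have X4 : hi - lo <= eps / 2.
  have : (hi - lo) <= k ^+ 2 * (eps / 2) by lra.
  have : k ^+ 2 <= 1 by rewrite expr_le1 //; lra.
  move=> h1 h2; apply: (le_trans h2); by apply: ler_piMl => //; lra.
have wd0 : 0 < w + d by lra.
have Z0 : 0 <= d / (w + d) by rewrite divr_ge0 // ltW.
have Z1 : d / (w + d) <= eps.
  rewrite ler_pdivrMr //; have : w * s <= w * eps by rewrite ler_wpM2l // ltW.
  have : 0 <= eps * d by rewrite mulr_ge0 // ltW.
  lra.
have Z2 : d / (w + d) <= 1 by rewrite ler_pdivrMr // mul1r; lra.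
have Y2 : (hi - lo) / Mx <= 1.
  rewrite ler_pdivrMr // mul1r /Mx.
  have : 0 <= lo * (1 - hi) by rewrite mulr_ge0 //; lra.
  lra.
apply: prod3_near1 => //; rewrite ?X0 ?Y0 ?Z0 //; lra.
Qed.

Lemma rates_gap_ok (a b lam g : R) (rt : rates R) : 0 < g -> a < b -> 0 <= lam ->
  rates_gap a b lam g rt -> rates_ok rt.
Proof. by move=> g0 ab lam0 [[h1 h2 h3] [h4 h5 h6]]; split; lra. Qed.

(** The factor [1 - X] in [error_rate], where [X >= 4 g], leaves a margin of at least [g^4] below
    the guaranteed gain. Three portions of [g^4 / 4] pay for the slack of one round, the deviation
    of the total and the scores of L. *)
Lemma error_rate_bounds (a b lam g : R) (rt : rates R) :
  0 < g -> a < b -> 0 <= lam -> rates_gap a b lam g rt ->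
  let th := (q1 rt - qmin rt) * (qmax rt - q2 rt) / (q1 rt - qmin rt + (qmax rt - q2 rt)) in
  let Mx := qmax rt * (1 - qmin rt) in
  [/\ g ^+ 4 / 2 <= error_rate rt,
      error_rate rt + 3 * (g ^+ 4 / 4) <= th / (2 * Mx * rate_mass rt),
      0 <= th / Mx & th / Mx <= (g ^+ 2)^-1].
Proof.
move=> g0 ab lam0 gap th Mx; have ok := rates_gap_ok g0 ab lam0 gap.
have [[h1 h2 h3] [h4 h5 h6]] := gap.
have N0 := rate_mass_gt0 ok; have := rate_mass_le ok.
have W0 := rate_min_gt0 ok.
rewrite /error_rate -/th -/Mx.
set W := _ + 2 * _ + _; set m0 := qmin rt * (1 - qmax rt) => NW.
have g2 : 0 < g ^+ 2 by rewrite exprn_gt0.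
have v0 : 0 < q1 rt - qmin rt + (qmax rt - q2 rt) by lra.
have th1 : th <= 1.
  rewrite /th ler_pdivrMr // mul1r.
  apply: (@le_trans _ _ (1 * (qmax rt - q2 rt))); last by lra.
  by rewrite ler_wpM2r //; lra.
have thg : g / 2 <= th.
  rewrite /th ler_pdivlMr //.
  have e1 : 0 <= (q1 rt - qmin rt - g) * (qmax rt - q2 rt) by rewrite mulr_ge0; lra.
  have e2 : 0 <= (q1 rt - qmin rt) * (qmax rt - q2 rt - g) by rewrite mulr_ge0; lra.
  lra.
have m0g : g ^+ 2 <= m0 by rewrite expr2 /m0; apply: ler_pM; lra.
have Mx1 : Mx <= 1 by rewrite /Mx mulr_ile1; lra.
have Mxm : m0 <= Mx by rewrite /m0 /Mx; have := h1; nra.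
have Mx0 : 0 < Mx by lra.
have th0 : 0 < th by lra.
have WW : 0 < W by rewrite /W; lra.
have W2 : W <= 2 by rewrite /W; lra.
set X := qmax rt - qmin rt.
have X1 : 4 * g <= X by rewrite /X; lra.
have X2 : X <= 1 - 2 * g by rewrite /X; lra.
have base_ge : g ^+ 3 / 4 <= m0 / Mx * th / W.
  apply: (@le_trans _ _ (g ^+ 2 * (g / 2) / 2)); first by rewrite exprSr; lra.
  have a1 : g ^+ 2 <= m0 / Mx.
    apply: (le_trans m0g); rewrite ler_pdivlMr // ler_piMr //; lra.
  have a2 : g ^+ 2 * (g / 2) <= m0 / Mx * th by apply: ler_pM => //; lra.
  apply: ler_pM => //.
    by rewrite mulr_ge0 ?divr_ge0 //; lra.
  by rewrite lef_pV2 ?posrE.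
set be := m0 / Mx * th / W in base_ge *.
have -> : (1 - X) * (m0 / Mx) * th / W = (1 - X) * be by rewrite /be !mulrA.
have g3 : 0 < g ^+ 3 by rewrite exprn_gt0.
split.
- have -> : g ^+ 4 / 2 = 2 * g * (g ^+ 3 / 4) by rewrite exprS; field.
  by apply: ler_pM => //; lra.
- apply: (@le_trans _ _ be).
    have : 4 * g * (g ^+ 3 / 4) <= X * be by apply: ler_pM => //; lra.
    have : 0 < g ^+ 4 by rewrite exprn_gt0.
    rewrite [g ^+ 4]exprS; lra.
  have -> : be = th / (2 * Mx * (W / (2 * m0))).
    by rewrite /be; field; rewrite ?gt_eqF //; lra.
  have p0 : 0 < 2 * Mx by rewrite mulr_gt0.
  have p1 : 0 < 2 * Mx * rate_mass rt by rewrite mulr_gt0.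
  have p2 : 0 < 2 * Mx * (W / (2 * m0)).
    by apply: mulr_gt0 => //; apply: divr_gt0 => //; apply: mulr_gt0.
  by rewrite ler_pM2l // lef_pV2 ?posrE // ler_pM2l.
- by apply: divr_ge0; exact: ltW.
- apply: (@le_trans _ _ (1 / Mx)); first by rewrite ler_pM2r // invr_gt0.
  by rewrite div1r lef_pV2 ?posrE //; lra.
Qed.

End ErrorRate.

(** * The attack *)

Section Scales.
Variable R : realType.
Implicit Types g l n r La K kap eps : R.

(** The tilt [lam = sqrt (La / r)] balances the deviation term [lam sq] against the variance term
    [r lam^2]: both equal [La]. *)
Lemma score_scale r La : 1 <= La -> 4 * La <= r ->
  let sq := Num.sqrt (r * La) in let lam := La / sq in
  [/\ 1 <= sq, sq ^+ 2 = r * La, lam * sq = La & r * lam ^+ 2 = La] /\ 0 <= lam <= 1 / 2.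
Proof.
move=> La1 La4 sq lam.
have rLa1 : 1 <= r * La by rewrite -[leLHS]mulr1; apply: ler_pM; lra.
have sq2 : sq ^+ 2 = r * La by rewrite sqr_sqrtr //; lra.
have sq1 : 1 <= sq by rewrite -[leLHS]sqrtr1 ler_wsqrtr.
have sq0 : 0 < sq by lra.
split.
  split => //; first by rewrite /lam mulfVK // gt_eqF.
  rewrite /lam exprMn exprVn sq2; field.
  by rewrite ?gt_eqF //; lra.
apply/andP; split; first by rewrite /lam divr_ge0 //; lra.
rewrite /lam ler_pdivrMr // -(ler_pXn2r (n := 2)) ?nnegrE //; try lra.
rewrite exprMn sq2; have : 0 <= (r - 4 * La) * La by rewrite mulr_ge0; lra.
by rewrite !expr2; lra.
Qed.

(** [m = eps / (4 T^2)] maximizes [m eps - 2 (m T)^2], with value [eps^2 / (8 T^2)]. *)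
Lemma tilt g l eps kap : 0 < g -> g <= 1 -> 1 <= l -> 0 < eps -> eps <= 1 ->
  kap <= (g ^+ 2)^-1 ->
  let T := 2 * l / g ^+ 2 in let m := eps / (4 * T ^+ 2) in
  [/\ 1 + kap * l <= T, 0 <= m, m * T <= 1 / 2 &
      m * eps - 2 * (m * T) ^+ 2 = (eps * g ^+ 2) ^+ 2 / (32 * l ^+ 2)].
Proof.
move=> g0 g1 l1 eps0 eps1 kapg T m.
have g2 : 0 < g ^+ 2 by rewrite exprn_gt0.
have g21 : g ^+ 2 <= 1 by rewrite exprn_ile1 // ltW.
have T1 : 2 <= T by rewrite /T ler_pdivlMr //; lra.
have T0 : 0 < T by lra.
have T20 : 0 < T ^+ 2 by rewrite exprn_gt0.
have mT : m * T = eps / (4 * T) by rewrite /m; field; rewrite ?gt_eqF.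
split.
- have k1 : kap * l <= (g ^+ 2)^-1 * l by rewrite ler_wpM2r //; lra.
  have k2 : l <= (g ^+ 2)^-1 * l by rewrite ler_peMl ?invf_ge1 //; lra.
  by rewrite /T; lra.
- by rewrite /m divr_ge0 // ?ltW // mulr_gt0.
- have key (t : R) : 2 <= t -> eps / (4 * t) <= 1 / 2.
    by move=> t2; rewrite ler_pdivrMr; lra.
  by rewrite mT; exact: key.
- rewrite mT /m /T; field.
  by rewrite ?gt_eqF //; lra.
Qed.

(** Each of the three terms is at most [1 / (g^2 n)]. *)
Lemma round_slack g n l eps kap : 0 < g -> g <= 1 -> 1 <= n -> 0 <= l -> l <= n ->
  0 < eps -> 3 / (g ^+ 2 * eps) <= n -> 0 <= kap -> kap <= (g ^+ 2)^-1 ->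
  kap * (l * n ^- 3) + n ^- 3 + n / (g * n) ^+ 2 <= eps.
Proof.
move=> g0 g1 n1 l0 ln_ eps0 nbig kap0 kapg.
have n0 : 0 < n by lra.
have g2 : 0 < g ^+ 2 by rewrite exprn_gt0.
have g21 : g ^+ 2 <= 1 by rewrite exprn_ile1 // ltW.
have d0 : 0 <= n ^- 3 by rewrite invr_ge0 exprn_ge0 // ltW.
have e : (g ^+ 2)^-1 / n * 3 <= eps.
  move: nbig; rewrite ler_pdivrMr ?mulr_gt0 // => nb.
  have -> : (g ^+ 2)^-1 / n * 3 = 3 / (g ^+ 2 * n) by field; rewrite ?gt_eqF.
  by rewrite ler_pdivrMr ?mulr_gt0 //; lra.
have i1 : 1 <= (g ^+ 2)^-1 by rewrite invf_ge1.
have nd : n * n ^- 3 <= n^-1.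
  have -> : n * n ^- 3 = n^-1 * n^-1 by field; rewrite ?gt_eqF.
  by rewrite ler_piMr ?invr_ge0 ?invf_le1 // ltW.
have j1 : kap * (l * n ^- 3) <= (g ^+ 2)^-1 / n.
  apply: ler_pM => //; first by rewrite mulr_ge0.
  by apply: le_trans nd; rewrite ler_wpM2r.
have j2 : n ^- 3 <= (g ^+ 2)^-1 / n.
  rewrite -[leLHS]mul1r; apply: ler_pM => //.
  by apply: le_trans nd; rewrite ler_peMl.
have j3 : n / (g * n) ^+ 2 = (g ^+ 2)^-1 / n by field; rewrite ?gt_eqF.
lra.
Qed.

(** Here the number of rounds is decided: what L can absorb, of order [l sqrt (r ln n)], falls below
    a fraction of [r] once [r] is a large multiple of [l^2 ln n]. The constant 66 is three times 22,
    and the factor 3 absorbs [La <= 5 ln n]. *)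
Lemma score_residual g K n l r La sq eps kap : 0 < g -> 0 < eps -> 1 <= l -> 1 <= n ->
  (66 / (eps * g ^+ 2)) ^+ 2 <= K -> K * l ^+ 2 * ln n <= r -> La <= 5 * ln n ->
  0 <= sq -> sq ^+ 2 = r * La -> 0 <= r -> 0 <= kap -> kap <= (g ^+ 2)^-1 ->
  kap * (l * (22 * sq)) <= eps * r.
Proof.
move=> g0 eps0 l1 n1 Kbig rK La5 sq0 sq2 r0 kap0 kapg.
have g2 : 0 < g ^+ 2 by rewrite exprn_gt0.
have lnn : 0 <= ln n by rewrite ln_ge0.
have eg0 : 0 < eps * g ^+ 2 by rewrite mulr_gt0.
move: Kbig; set y := 66 / (eps * g ^+ 2) => Kbig.
have y0 : 0 < y by rewrite divr_gt0.
have yl0 : 0 <= (y * l) ^+ 2 by rewrite sqr_ge0.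
have ysq : y * l * sq <= 3 * r.
  have p1 : 0 <= y * l * sq by apply: mulr_ge0 => //; apply: mulr_ge0; lra.
  have p2 : 0 <= 3 * r by lra.
  rewrite -(ler_pXn2r (n := 2)) ?nnegrE // (exprMn 2 (y * l)) sq2.
  have h1 : (y * l) ^+ 2 * ln n <= r.
    apply: le_trans rK; rewrite ler_wpM2r // exprMn ler_wpM2r // sqr_ge0 //.
  have h2 : (y * l) ^+ 2 * La <= 5 * r.
    by have : (y * l) ^+ 2 * La <= (y * l) ^+ 2 * (5 * ln n); [rewrite ler_wpM2l|lra].
  have : (y * l) ^+ 2 * La * r <= 5 * r * r by rewrite ler_wpM2r.
  have : 0 <= r * r by rewrite mulr_ge0.
  by rewrite !expr2; lra.
apply: (@le_trans _ _ ((g ^+ 2)^-1 * (l * (22 * sq)))).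
  by apply: ler_wpM2r => //; apply: mulr_ge0; lra.
have -> : (g ^+ 2)^-1 * (l * (22 * sq)) = eps / 3 * (y * l * sq).
  by rewrite /y; field; rewrite ?gt_eqF.
have : eps * (y * l * sq) <= eps * (3 * r) by rewrite ler_pM2l.
lra.
Qed.

Lemma total_exponent g K n l r eps : 0 < g -> 0 < eps -> 1 <= l -> 1 <= n ->
  (66 / (eps * g ^+ 2)) ^+ 2 <= K -> K * l ^+ 2 * ln n <= r ->
  ln n <= r * ((eps * g ^+ 2) ^+ 2 / (32 * l ^+ 2)).
Proof.
move=> g0 eps0 l1 n1 Kbig rK.
have eg0 : 0 < eps * g ^+ 2 by rewrite mulr_gt0 // exprn_gt0.
have lnn : 0 <= ln n by rewrite ln_ge0.
have l0 : 0 < l by lra.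
have l2 : 0 < l ^+ 2 by rewrite exprn_gt0.
move: Kbig; rewrite exprMn exprVn ler_pdivrMr ?exprn_gt0 // => Kbig.
set e := (eps * g ^+ 2) ^+ 2 in Kbig *.
have K1 : 32 <= K * e by apply: le_trans Kbig; rewrite expr2; lra.
have e0 : 0 <= e by rewrite sqr_ge0.
rewrite mulrA ler_pdivlMr ?mulr_gt0 //.
apply: (@le_trans _ _ (K * l ^+ 2 * ln n * e)); last by rewrite ler_wpM2r.
have -> : K * l ^+ 2 * ln n * e = K * e * (l ^+ 2 * ln n) by ring.
have -> : ln n * (32 * l ^+ 2) = 32 * (l ^+ 2 * ln n) by ring.
by rewrite ler_wpM2r // mulr_ge0 // ltW.
Qed.

(** The exponent is [- 4 La + 2 La] plus the drift, at most [K - 2 ln n], against at most [2 n]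
    terms. Since [r] is at most [2 K n^3], a distance of [n^-3] makes the total drift bounded. *)
Lemma pot_out_ledger0 (U : finType) (L : {set U}) (r : nat) (K La sq lam : R) :
  let n : R := #|U|%:R in 1 <= n ->
  r%:R <= 2 * K * n ^+ 3 -> ln n <= La -> lam * sq = La -> r%:R * lam ^+ 2 = La ->
  0 <= lam <= 1 / 2 ->
  pot_out L (4 * sq) lam (n ^- 3) r (ledger0 R U) <= 2 * expR K / n.
Proof.
move=> n n1 r3 lnLa lamsq lam2 /andP[lam0 lam1].
have n0 : 0 < n by lra.
have d0 : 0 <= n ^- 3 by rewrite invr_ge0 exprn_ge0 // ltW.
rewrite /pot_out /=.
have -> : \sum_(x : U | x \notin L) (expR (lam * 0) + expR (- lam * 0)) =
    \sum_(x : U | x \notin L) (2 : R).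
  by apply: eq_bigr => x _; rewrite !mulr0 expR0.
have c1 : \sum_(x : U | x \notin L) (2 : R) <= n * 2.
  rewrite sumr_const -[leLHS]mulr_natl; apply: ler_wpM2r => //.
  by rewrite ler_nat max_card.
have rd : r%:R * n ^- 3 <= 2 * K by rewrite ler_pdivrMr ?exprn_gt0.
have c2 : expR (- lam * (4 * sq) + r%:R * (lam * n ^- 3 + 2 * lam ^+ 2)) <= expR K / (n * n).
  have -> : n * n = expR (2 * ln n) by rewrite mulr_natl mulr2n expRD lnK // posrE.
  rewrite -expRN -expRD ler_expR.
  have -> : - lam * (4 * sq) + r%:R * (lam * n ^- 3 + 2 * lam ^+ 2) =
      - 4 * (lam * sq) + lam * (r%:R * n ^- 3) + 2 * (r%:R * lam ^+ 2) by ring.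
  rewrite lamsq lam2.
  have : lam * (r%:R * n ^- 3) <= 1 / 2 * (2 * K) by apply: ler_pM => //; rewrite mulr_ge0.
  lra.
apply: (@le_trans _ _ (n * 2 * (expR K / (n * n)))).
  by apply: ler_pM => //; exact: sumr_ge0.
rewrite le_eqVlt; apply/orP; left; apply/eqP; field.
by rewrite gt_eqF.
Qed.

(** A score in L is at most [D + 1 + thr + 1] with [D = 4 sq] and [thr = 16 sq], and [1 <= sq]. *)
Lemma score_sum_le (U : finType) (L : {set U}) (a : ledger R U) (sq kap : R) :
  1 <= sq -> 0 <= kap -> ledger_inv L (4 * sq + 1 + 16 * sq) a ->
  kap * \sum_(x in L) adv a x <= kap * (#|L|%:R * (22 * sq)).
Proof.
move=> sq1 kap0 [_ _ hL]; apply: ler_wpM2l => //.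
have -> : #|L|%:R * (22 * sq) = \sum_(x in L) 22 * sq by rewrite sumr_const mulr_natl.
apply: ler_sum => x xL; apply: (le_trans (hL x xL)).
by case: (x \in _); rewrite ?mulr1n ?mulr0n; lra.
Qed.

End Scales.

Lemma attack_prob_ge (R : realType) (U : finType)
    (dX : measure_display) (X : measurableType dX)
    (dS : measure_display) (Sg : measurableType dS) (S : {set U} -> X -> Sg)
    (Aux : {set U} -> {set U} -> probability X R) (rt : rates R) (delta : R)
    (L : {set U}) (qr : responder R U X Sg) (a b g K : R) :
  let n : R := #|U|%:R in
  let l : R := #|L|%:R in
  let eps := g ^+ 4 / 4 in
  let r := `|Num.ceil (K * l ^+ 2 * ln n)|%N in
  0 < g -> a < b -> rates_gap a b (l / n) g rt ->
  20 <= K -> (66 / (eps * g ^+ 2)) ^+ 2 <= K ->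
  expR 1 <= n -> 2 * K <= n -> 3 / (g ^+ 2 * eps) <= n ->
  1 <= l -> 2 * l < n ->
  (forall V : {set U}, measurable_fun setT (S V)) ->
  delta < n ^- 3 -> determining_pool S Aux rt delta L ->
  ((1 - (2 * expR K + 1) / n)%:E <=
    attack_prob S Aux rt qr r
      (fun h => (error_rate rt * r%:R <= (errors (a * n) (b * n) r h)%:R)%R))%E.
Proof.
move=> n l eps r g0 ab gap K20 Kbig en Kn nbig l1 l2n mS dn pool.
have l0 : 0 <= l by rewrite ler0n.
have ln_ : l <= n by clear -l2n l1; lra.
have n1 : 1 <= n by clear -ln_ l1; lra.
have n0 : 0 < n by clear -n1; lra.
have lam0 : 0 <= l / n by rewrite divr_ge0 // ltW.
have ok := rates_gap_ok g0 ab lam0 gap.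
have [_ e2 kap0 kapg] := error_rate_bounds g0 ab lam0 gap.
have [[h1 h2 h3] [h4 h5 h6]] := gap.
have g1 : g <= 1 by case: ok => *; lra.
have [rK r3 lnn lnLa La5] := rounds_bounds K20 en Kn l1 ln_.
rewrite -/r in rK r3 lnLa La5.
move: lnLa La5; set La := ln (r%:R * n) => lnLa La5.
move: e2 kap0 kapg; set th := (q1 rt - qmin rt) * _ / _; set Mx := qmax rt * _.
set be := th / (2 * Mx * _); set kap := th / Mx => e2 kap0 kapg.
have eps0 : 0 < eps by rewrite /eps divr_gt0 // exprn_gt0.
have eps1 : eps <= 1.
  by rewrite /eps ler_pdivrMr // mul1r (@le_trans _ _ 1) ?ler1n // exprn_ile1 // ltW.
have rln : 20 * ln n <= r%:R.
  apply: le_trans rK; apply: ler_wpM2r; first by clear -lnn; lra.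
  rewrite -[leLHS]mulr1; apply: ler_pM => //.
  by rewrite exprn_ege1.
have La1 : 1 <= La by clear -lnn lnLa; lra.
have La4 : 4 * La <= r%:R by clear -rln La5; lra.
have r0 : 0 <= r%:R :> R by rewrite ler0n.
have [[sq1 sq2 lamsq lam2] lam01] := score_scale La1 La4.
move: sq1 sq2 lamsq lam2 lam01; set sq := Num.sqrt _; set lam := La / sq.
move=> sq1 sq2 lamsq lam2 lam01; have /andP[lamge0 lamle] := lam01.
have sq0 : 0 <= sq by clear -sq1; lra.
have [kT m0 mT mE] := tilt g0 g1 l1 eps0 eps1 kapg.
move: kT m0 mT mE; set T := 2 * l / _; set m := eps / _ => kT m0 mT mE.
have slack := round_slack g0 g1 n1 l0 ln_ eps0 nbig kap0 kapg.
have d0 : 0 <= n ^- 3 by rewrite invr_ge0 exprn_ge0 // ltW.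
(* The mean gain per round is at least [be - eps]; the second [eps] is the deviation allowed to the
   total, and a third is spent in [final] on the scores of L. *)
pose H0 := (be - 2 * eps) * r%:R.
pose sig := 2 * (m * T) ^+ 2 - m * (be - eps).
have thrE : 16 * Num.sqrt (r%:R * ln (r%:R * #|U|%:R)) = 16 * sq by [].
have Lhalf : (2 * #|L| < #|U|)%N by rewrite -(ltr_nat R) natrM.
have Dthr : 2 * (4 * sq) + 1 < 16 * Num.sqrt (r%:R * ln (r%:R * #|U|%:R)).
  by rewrite thrE; clear -sq1; lra.
have gainR (M : {set U}) (p : {set U} -> R) (p' : {set U} -> {set U} -> R) : M \subset L ->
    (forall q, qmin rt <= q <= qmax rt -> shadowed L M p (p' M) (n ^- 3) q) ->
    rate_int rt (fun q => mean p (fun W z => expR (- m * gain L M (a * n) (b * n) kap q W z)) q) <=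
    expR sig * rate_mass rt.
  by move=> ML sh; exact: (mean_exp_gain_rate ok g0 n0 h3 h4 slack d0 kT m0 mT ML sh).
have final (h : seq (round R U X)) :
    ledger_inv L (4 * sq + 1 + 16 * Num.sqrt (r%:R * ln (r%:R * #|U|%:R)))
      (ledger_after r (a * n) (b * n) h) ->
    H0 < (errs (ledger_after r (a * n) (b * n) h))%:R +
      kap * \sum_(x in L) adv (ledger_after r (a * n) (b * n) h) x ->
    error_rate rt * r%:R <= (errors (a * n) (b * n) r h)%:R.
  rewrite thrE => inv hH; rewrite -errs_ledger_after.
  have s1 := score_sum_le sq1 kap0 inv.
  have s2 := score_residual g0 eps0 l1 n1 Kbig rK La5 sq0 sq2 r0 kap0 kapg.
  have s3 : (error_rate rt + 3 * eps) * r%:R <= be * r%:R by rewrite ler_wpM2r.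
  move: hH (le_trans s1 s2) s3; rewrite /H0.
  set u := kap * _; set v := (errs _)%:R; set w := error_rate rt; clear; lra.
have main := @transcript_prob_pot R U dX X dS Sg S Aux rt delta L qr r (a * n) (b * n)
  (4 * sq) lam kap m sig H0 (n ^- 3) _ mS ok pool (ltW dn) Lhalf Dthr lamge0 lamle d0 m0
  gainR final r 0%N [tuple].
rewrite /attack_prob; apply: le_trans (main _); last first.
  by apply: ledger_inv0; rewrite thrE; clear -sq1; lra.
rewrite lee_fin lerD2l lerN2.
have -> : ledger_after r (a * n) (b * n) [tuple] = ledger0 R U by [].
rewrite /pot [leRHS]mulrDl; apply: lerD; first exact: pot_out_ledger0 lamsq lam2 lam01.
rewrite /pot_total /= big1 // mulr0 addr0 add0r div1r.
have -> : n^-1 = expR (- ln n) by rewrite expRN lnK // posrE.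
rewrite ler_expR.
have -> : - m * - H0 + r%:R * sig = - (r%:R * (m * eps - 2 * (m * T) ^+ 2)).
  by rewrite /H0 /sig; ring.
by rewrite lerN2 mE; exact: (total_exponent g0 eps0 l1 n1 Kbig rK).
Qed.

Theorem mainTheorem1 (R : realType) :
  exists eta : R -> R -> R -> rates R -> R,
  (forall a b c g : R, 0 < a -> a < b -> b < 1 -> 0 < c -> 0 < g ->
    exists eta0 K C : R, [/\ 0 < eta0, 0 < K & 0 < C] /\
    forall (U : finType) (dX : measure_display) (X : measurableType dX)
      (dS : measure_display) (Sg : measurableType dS)
      (S : {set U} -> X -> Sg)
      (Aux : {set U} -> {set U} -> probability X R)
      (rt : rates R) (delta : R) (L : {set U}) (qr : responder R U X Sg),
    let n : R := #|U|%:R in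
    let l : R := #|L|%:R in
    let r : nat := `|Num.ceil (K * l ^+ 2 * ln n)|%N in
    let et : R := eta a b (l / n) rt in
    (forall V : {set U}, measurable_fun setT (S V)) ->
    l <= Num.min (a * n) (n / 2) - c * n ->
    delta < n ^- 3 ->
    rates_gap a b (l / n) g rt ->
    determining_pool S Aux rt delta L ->
    eta0 <= et /\
    ((1 - C / n)%:E <=
      attack_prob S Aux rt qr r
        (fun h => (et * r%:R <= (errors (a * n) (b * n) r h)%:R)%R))%E) /\
  (forall k eps : R, 0 < k -> 0 < eps ->
    exists th g : R, [/\ 0 < th & 0 < g] /\
    forall a b lam : R, k <= a -> a < b -> b <= 1 - k ->
      b / a <= 1 + th -> 0 <= lam -> lam <= th ->
      exists rt : rates R,
        rates_gap a b lam g rt /\ `|eta a b lam rt - 4^-1| < eps).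
Proof.
exists (fun _ _ _ => @error_rate R); split; last exact: error_rate_limit.
move=> a b c g a0 ab b1 c0 g0.
pose eps := g ^+ 4 / 4.
have g4 : 0 < g ^+ 4 by rewrite exprn_gt0.
have eps0 : 0 < eps by rewrite /eps; lra.
have Kbig0 : 0 <= (66 / (eps * g ^+ 2)) ^+ 2 by rewrite sqr_ge0.
have q1 : 0 < 3 / (g ^+ 2 * eps) by rewrite divr_gt0 // mulr_gt0 // exprn_gt0.
pose K := 20 + (66 / (eps * g ^+ 2)) ^+ 2.
pose n0 := expR 1 + 2 * K + 3 / (g ^+ 2 * eps).
have K0 : 0 < K by rewrite /K; lra.
have E1 := expR_gt0 (1 : R); have EK := expR_gt0 K.
(* The constant contains [n0], so that below [n0] the claimed probability is not positive. *)
exists (g ^+ 4 / 2), K, (n0 + (2 * expR K + 1)).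
split; first by split => //; rewrite ?divr_gt0 // /n0; lra.
move=> U dX X dS Sg S Aux rt delta L qr n l r et mS lmin dn gap pool.
have l0 : 0 <= l by rewrite ler0n.
have nn : 0 <= n by rewrite ler0n.
have lam0 : 0 <= l / n by rewrite divr_ge0.
have ok := rates_gap_ok g0 ab lam0 gap.
have [et0 _ _ _] := error_rate_bounds g0 ab lam0 gap.
split; first exact: et0.
have [n00|nge] := ltP n n0.
  have [np|np] := ltP 0 n.
    apply: (@le_trans _ _ 0%E); last exact: transcript_prob_ge0.
    by rewrite lee_fin subr_le0 ler_pdivlMr // mul1r; lra.
  (* Division by 0 gives 0, so for an empty ground set the claim is probability 1; it holds because
     there are no rounds. An empty pool below is likewise settled by [r = 0]. *)
  have n_0 : n = 0 by lra.
  have lz : l = 0.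
    have : l <= n by rewrite ler_nat max_card.
    lra.
  have rz : r = 0%N by rewrite /r lz expr0n mulr0 mul0r ceil0.
  by rewrite /attack_prob rz /= mulr0 ler0n n_0 invr0 mulr0 subr0.
have n1 : 0 < n by move: nge; rewrite /n0; lra.
have [lz|l1] := eqVneq #|L| 0%N.
  have rz : r = 0%N by rewrite /r /l lz expr0n mulr0 mul0r ceil0.
  rewrite /attack_prob rz /= mulr0 ler0n lee_fin lerBlDr lerDl divr_ge0 //.
  by rewrite /n0; lra.
have l1' : 1 <= l by rewrite ler1n lt0n.
have l2 : 2 * l < n.
  have : 0 < c * n by rewrite mulr_gt0.
  have : Num.min (a * n) (n / 2) <= n / 2 by rewrite ge_min lexx orbT.
  lra.
have K20 : 20 <= K by rewrite /K; lra.
have Kb : (66 / (eps * g ^+ 2)) ^+ 2 <= K by rewrite /K; lra.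
have n_1 : expR 1 <= n by move: nge; rewrite /n0; lra.
have n_2 : 2 * K <= n by move: nge; rewrite /n0; lra.
have n_3 : 3 / (g ^+ 2 * eps) <= n by move: nge; rewrite /n0; lra.
apply: le_trans (attack_prob_ge qr g0 ab gap K20 Kb n_1 n_2 n_3 l1' l2 mS dn pool).
rewrite lee_fin lerD2l lerN2 ler_pM2r ?invr_gt0 //.
by rewrite /n0; lra.
Qed.
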